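(* Let $G(\lambda)\in\mathbb{C}(\lambda)^{r\times r}$ be a rational matrix with a skew-symmetric realization $G(\lambda)=D(\lambda)+B^TA(\lambda)^{-1}B$, i.e. $A(\lambda)=\sum_{j=0}^m\lambda^jA_j\in\mathbb{C}[\lambda]^{n\times n}$ is regular of degree $m$, $D(\lambda)=\sum_{j=0}^k\lambda^jD_j\in\mathbb{C}[\lambda]^{r\times r}$ has degree $k$, $A(\lambda)^T=-A(\lambda)$, $D(\lambda)^T=-D(\lambda)$, and $B\in\mathbb{C}^{n\times r}$; let $\mathcal{S}(\lambda)=\begin{bmatrix}A(\lambda)&-B\\ B^T&D(\lambda)\end{bmatrix}$ be the corresponding system matrix. Let $h\in\{0,1,\dots,m-1\}$ be even, let $w$ be the simple admissible tuple of $\{0,1,\dots,h\}$ and $c_w$ its symmetric complement. Let $z_h+m$ be any admissible tuple of $\{0,1,\dots,m-h-1\}$ and $c_{z_h}+m$ the symmetric complement of $z_h+m$. Let $t_w$, with indices from $\{0,1,\dots,h-1\}$, and $t_{z_h}+m$, with indices from $\{0,1,\dots,m-h-2\}$, be right index tuples of type-1 relative to $\mathrm{rev}(w)$ and $\mathrm{rev}(z_h+m)$, respectively. Similarly, let $\ell\in\{0,1,\dots,k-1\}$ be even, let $v$ be the simple admissible tuple of $\{0,1,\dots,\ell\}$ and $c_v$ its symmetric complement. Let $z_\ell+k$ be any admissible tuple of $\{0,1,\dots,k-\ell-1\}$ and $c_{z_\ell}+k$ the symmetric complement of $z_\ell+k$. Let $t_v$, with indices from $\{0,1,\dots,\ell-1\}$,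 and $t_{z_\ell}+k$, with indices from $\{0,1,\dots,k-\ell-2\}$, be right index tuples of type-1 relative to $\mathrm{rev}(v)$ and $\mathrm{rev}(z_\ell+k)$, respectively. Put $$L_A(\lambda)=M^A_{\mathrm{rev}(t_{z_h})}M^A_{\mathrm{rev}(t_w)}\left(\lambda M^A_{z_h}-M^A_w\right)M^A_{c_w}M^A_{t_w}M^A_{c_{z_h}}M^A_{t_{z_h}},$$ $$L_D(\lambda)=N^D_{\mathrm{rev}(t_{z_\ell})}N^D_{\mathrm{rev}(t_v)}\left(\lambda N^D_{z_\ell}-N^D_v\right)N^D_{c_v}N^D_{t_v}N^D_{c_{z_\ell}}N^D_{t_{z_\ell}}.$$ Then there exist unique quasi-identity matrices $Q_A\in\mathbb{C}^{mn\times mn}$ and $Q_D\in\mathbb{C}^{kr\times kr}$ such that $$\mathbb{L}(\lambda)=\left[\begin{array}{c|c} Q_AL_A(\lambda) & e_{m-i_0(\mathrm{rev}(t_w),w)}e^T_{k-c_0(v,c_v,t_v)}\otimes(-B)\\ \hline e_{k-i_0(\mathrm{rev}(t_v),v)}e^T_{m-c_0(w,c_w,t_w)}\otimes B^T & Q_DL_D(\lambda)\end{array}\right]$$ is skew-symmetric. Moreover, when the leading coefficient of $A(\lambda)$ is singular, assume $\mathrm{Ind}(z_h+m)=0$; further, assume that $0\notin t_w$ (resp., $-m\notin t_{z_h}$) when $A_0$ (resp., $A_m$) is singular. Similarly, when the leading coefficient of $D(\lambda)$ is singular, assume $\mathrm{Ind}(z_\ell+k)=0$; further, assume that $0\notin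 t_v$ (resp., $-k\notin t_{z_\ell}$) when $D_0$ (resp., $D_k$) is singular. Then $\mathbb{L}(\lambda)$ is a Rosenbrock linearization of $G(\lambda)$.
   Context: A matrix pencil $P(\lambda)$ is skew-symmetric if $P(\lambda)^T=-P(\lambda)$. Elementary matrices. For $P\in\mathbb{C}^{n\times n}$ define $mn\times mn$ matrices $M_0(P)=\mathrm{diag}(I_{(m-1)n},P)$, $M_{-m}(P)=\mathrm{diag}(P,I_{(m-1)n})$, and for $i=1,\dots,m-1$: $M_i(P)=\mathrm{diag}\left(I_{(m-i-1)n},\begin{bmatrix}P&I_n\\ I_n&0\end{bmatrix},I_{(i-1)n}\right)$, $M_{-i}(P)=\mathrm{diag}\left(I_{(m-i-1)n},\begin{bmatrix}0&I_n\\ I_n&P\end{bmatrix},I_{(i-1)n}\right)$. Set $M_i^A=M_i(-A_i)$ for $i=0,\dots,m-1$ and $M_i^A=M_i(A_{-i})$ for $i=-1,\dots,-m$. The $kr\times kr$ matrices $N_i(P)$ and $N_i^D$ are defined in the same way with $(m,n,A)$ replaced by $(k,r,D)$. For a tuple $p=(p_1,\dots,p_s)$ of integers, $M^A_p=M^A_{p_1}\cdots M^A_{p_s}$ and $N^D_p=N^D_{p_1}\cdots N^D_{p_s}$ (identity if $p$ is empty). A permutation of a finite set is viewed as a tuple listing each element exactly once; $(s,t)$ denotes concatenation of tuples, $\mathrm{rev}$ reverses a tuple, $t+j$ adds $j$ to each entry, and $(a:b)=(a,a+1,\dots,b)$. Column standard form. For a permutation $\gamma$ of $\{0,\dots,p\}$,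 $\mathrm{csf}(\gamma)$ is the unique tuple of the form $(m_q:n_q,\,m_{q-1}:n_{q-1},\dots,m_1:n_1)$ with $0\le n_1<\dots<n_q\le p$ and $0\le m_i\le n_i$ that can be obtained from $\gamma$ by repeatedly interchanging adjacent entries $i,j$ with $|i-j|>1$. Thus $\mathrm{csf}(\gamma)=(b_d,b_{d-1},\dots,b_1)$ with strings $b_i=(a_{i-1}+1:a_i)$ for $i=1,\dots,d$, where $-1=a_0<a_1<\dots<a_d=p$. Admissible tuples. Let $p\ge0$. An admissible tuple of $\{0,\dots,p\}$ is a permutation $\gamma$ of $\{0,\dots,p\}$ with $\mathrm{csf}(\gamma)=(p-1:p,\,p-3:p-2,\dots,q+1:q+2,\,0:q)$ for some $0\le q\le p$; $q=\mathrm{Ind}(\gamma)$ is its index. It is simple if $q\in\{0,1\}$. Its symmetric complement is $c_\gamma=(p-1,p-3,\dots,q+3,q+1,(0:q)_{\mathrm{rev}_c})$ if $q\ge1$, where $(0:q)_{\mathrm{rev}_c}=(0:q-1,0:q-2,\dots,0:1,0)$; $c_\gamma=(p-1,p-3,\dots,1)$ if $q=0$ and $p>0$; and $c_\gamma=\emptyset$ if $p=0$. Right index tuples of type-1. Let $\alpha$ be a permutation of $\{0,\dots,p\}$ with $\mathrm{csf}(\alpha)=(b_d,b_{d-1},\dots,b_1)$, where $b_i=(a_{i-1}+1:a_i)$ for $i=1,\dots,d$ and $-1=a_0<a_1<\dots<a_d=p$. An index $s\in\{0,\dots,p-1\}$ is a right index of type-1 relative to $\alpha$ if some string $b_i$ equals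 $(s:t)$ with $s<t$. For such $s$, the associated simple tuple $z_r(\alpha,s)$ is: if $s=a_{j-1}+1\ne0$, $z_r(\alpha,s)=(b_d,\dots,b_{j+1},\tilde b_j,\tilde b_{j-1},b_{j-2},\dots,b_1)$ with $\tilde b_j=(a_{j-1}+2:a_j)$ and $\tilde b_{j-1}=(a_{j-2}+1:a_{j-1}+1)$; if $s=0$, $z_r(\alpha,0)=(b_d,\dots,b_2,\tilde b_1,\tilde b_0)$ with $\tilde b_1=(1:a_1)$ and $\tilde b_0=(0)$. An index tuple $(s_1,\dots,s_q)$ (possibly empty) is a right index tuple of type-1 relative to $\alpha$ if, for each $i=1,\dots,q$, $s_i$ is a right index of type-1 relative to $z_r(\alpha,(s_1,\dots,s_{i-1}))$, where $z_r(\alpha,\emptyset)=\alpha$ and $z_r(\alpha,(s_1,\dots,s_{i-1}))=z_r(z_r(\alpha,(s_1,\dots,s_{i-2})),s_{i-1})$. Consecutions and inversions. A subtuple is obtained by deleting some (possibly no) entries, keeping the order. For a tuple $\gamma$ of nonnegative integers containing $0$, $c_0(\gamma)$ is the largest $s$ such that $(0,1,\dots,s)$ is a subtuple of $\gamma$, and $i_0(\gamma)$ is the largest $s$ such that $(s,\dots,1,0)$ is a subtuple of $\gamma$. A quasi-identity matrix in $\mathbb{C}^{mn\times mn}$ is $\epsilon_1I_n\oplus\dots\oplus\epsilon_mI_n$ with $\epsilon_i\in\{1,-1\}$; in $\mathbb{C}^{kr\times kr}$ it is $\epsilon_1I_r\oplus\dots\oplus\epsilon_kI_r$ with $\epsilon_i\in\{1,-1\}$.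 $e_j$ denotes the $j$-th standard basis (column) vector, of $\mathbb{C}^m$ when written $e_{m-\cdot}$ and of $\mathbb{C}^k$ when written $e_{k-\cdot}$; $\otimes$ is the Kronecker product. Rosenbrock linearization. A pencil $\mathbb{L}(\lambda)$ of size $mn+kr$ is a Rosenbrock linearization of $G(\lambda)$, with system matrix $\mathcal{S}(\lambda)$, if there are unimodular matrix polynomials $U_A,V_A$ of size $mn$ and $U_D,V_D$ of size $kr$ with $\mathrm{diag}(U_A,U_D)\,\mathbb{L}\,\mathrm{diag}(V_A,V_D)=\mathrm{diag}(I_{(m-1)n},\mathcal{S},I_{(k-1)r})$.
   Formalization: Uniqueness of Q_A, Q_D is stated up to sign of each (−Q_A, −Q_D also make the pencil skew-symmetric), and only if A_0 ≠ 0 when 0 ∈ t_w (resp. D_0 ≠ 0 when 0 ∈ t_v); the linearization claim concerns the Q_A, Q_D asserted to exist. *)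

(* Defs.v *)
From mathcomp Require Import all_boot all_order all_algebra.
From mathcomp Require Import reals complex mxtens.

Set Implicit Arguments.
Unset Strict Implicit.
Unset Printing Implicit Defensive.

Import GRing.Theory.
Local Open Scope ring_scope.

Section IndexTuples.
Local Open Scope nat_scope.

(* A string (a : b) = (a, a+1, ..., b); it is empty when b < a. *)
Definition str (a b : nat) : seq nat := iota a (b.+1 - a).

Definition strs (bs : seq (nat * nat)) : seq nat :=
  flatten [seq str b.1 b.2 | b <- bs].

Inductive commutes_to : seq nat -> seq nat -> Prop :=
| CommRefl s : commutes_to s s
| CommSwap s t i j u :
    (i.+1 < j) || (j.+1 < i) ->
    commutes_to (s ++ [:: j, i & t]) u ->
    commutes_to (s ++ [:: i, j & t]) u.

(* [csf p g bs] says that csf(g) = strs bs.  The strings are listed in the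
   order in which they occur in the tuple, that is (m_q, n_q), ..., (m_1, n_1). *)
Definition csf (p : nat) (g : seq nat) (bs : seq (nat * nat)) : Prop :=
  [/\ sorted (fun b b' => b'.2 < b.2) bs,
      all (fun b => b.1 <= b.2 <= p) bs
    & commutes_to g (strs bs)].

(* The strings p-1:p, p-3:p-2, ..., q+1:q+2, 0:q, for p - q even. *)
Definition adm_strings (p q : nat) : seq (nat * nat) :=
  [seq (q + i.*2.+1, q + i.*2.+2) | i <- rev (iota 0 (p - q)./2)]
    ++ [:: (0, q)].

(* g is an admissible tuple of {0, ..., p} with Ind(g) = q. *)
Definition admissible (p q : nat) (g : seq nat) : Prop :=
  [/\ perm_eq g (iota 0 p.+1), q <= p, ~~ odd (p - q)
    & csf p g (adm_strings p q)].

Definition simple_admissible (p q : nat) (g : seq nat) : Prop :=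
  admissible p q g /\ q \in [:: 0; 1].

(* (0:q)_{rev_c} = (0:q-1, 0:q-2, ..., 0:1, 0); empty for q = 0. *)
Definition revc (q : nat) : seq nat := flatten [seq iota 0 j | j <- rev (iota 1 q)].

(* The symmetric complement (p-1, p-3, ..., q+1, (0:q)_{rev_c}) of any admissible
   tuple of {0, ..., p} of index q; it depends on the tuple only through (p, q). *)
Definition symcompl (p q : nat) : seq nat :=
  [seq q + i.*2.+1 | i <- rev (iota 0 (p - q)./2)] ++ revc q.

(* Strings of alpha, type-1 index s, strings of z_r(alpha, s).  In the first case
   the string (c : d) is b_{j-1}, and d = s - 1 since the strings partition
   {0, ..., p}; in the second one (0 : t) is b_1, the last string. *)
Inductive zr_strings :
  seq (nat * nat) -> nat -> seq (nat * nat) -> Prop :=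
| ZrPos hi lo s t c d : s <> 0 -> s < t ->
    zr_strings (hi ++ [:: (s, t), (c, d) & lo]) s
               (hi ++ [:: (s.+1, t), (c, s) & lo])
| ZrZero hi t : 0 < t ->
    zr_strings (hi ++ [:: (0, t)]) 0 (hi ++ [:: (1, t); (0, 0)]).

(* s is a right index of type-1 relative to alpha, and z_r(alpha, s) = beta. *)
Definition right_index1 (p : nat) (alpha : seq nat) (s : nat) (beta : seq nat)
    : Prop :=
  s < p /\ exists bs bs', [/\ csf p alpha bs, zr_strings bs s bs'
                            & beta = strs bs'].

(* (s_1, ..., s_q) is a right index tuple of type-1 relative to alpha. *)
Inductive right_index_tuple1 (p : nat) : seq nat -> seq nat -> Prop :=
| Rit1Nil alpha : right_index_tuple1 p alpha [::]
| Rit1Cons alpha s beta t :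
    right_index1 p alpha s beta -> right_index_tuple1 p beta t ->
    right_index_tuple1 p alpha (s :: t).

(* Number of consecutions and of inversions of g at 0, for 0 \in g.  The bound
   s < size g on the maximum is harmless: a subtuple has at most size g entries. *)
Definition consecutions0 (g : seq nat) : nat :=
  \max_(s < size g | subseq (iota 0 s.+1) g) s.

Definition inversions0 (g : seq nat) : nat :=
  \max_(s < size g | subseq (rev (iota 0 s.+1)) g) s.

End IndexTuples.

Definition ztuple (s : seq nat) : seq int := [seq i%:Z | i <- s].

(* Turns z + m (entries >= 0) into z. *)
Definition shiftdown (m : nat) (s : seq nat) : seq int :=
  [seq i%:Z - m%:Z | i <- s].

Section Blocks.
Variable R : pzRingType.

(* The m x m block matrix with (a, b) block F a b. *)
Definition blocks (m n : nat) (F : 'I_m -> 'I_m -> 'M[R]_n) : 'M[R]_(m * n) :=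
  \sum_a \sum_b (delta_mx a b : 'M[R]_m) *t F a b.

(* Identity except for the diagonal block number s (counted from 0). *)
Definition embed1 (m n : nat) (s : nat) (P : 'M[R]_n) : 'M[R]_(m * n) :=
  blocks (fun a b : 'I_m =>
    if a == b then if val a == s then P else 1%:M else 0).

(* Identity except for [W, X; Y, Z] in the block rows and columns s, s+1. *)
Definition embed2 (m n : nat) (s : nat) (W X Y Z : 'M[R]_n) : 'M[R]_(m * n) :=
  blocks (fun a b : 'I_m =>
    if val a == s then
      if val b == s then W else if val b == s.+1 then X else 0
    else if val a == s.+1 then
      if val b == s then Y else if val b == s.+1 then Z else 0
    else if a == b then 1%:M else 0).

(* M_i(P), meant for -m <= i <= m-1. *)
Definition elemmx (m n : nat) (i : int) (P : 'M[R]_n) : 'M[R]_(m * n) :=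
  match i with
  | Posz 0 => embed1 m m.-1 P
  | Posz j => embed2 m (m - j - 1) P 1%:M 1%:M 0
  | Negz j => (* i = - j.+1 *)
      if j.+1 == m then embed1 m 0 P
      else embed2 m (m - j.+1 - 1) 0 1%:M 1%:M P
  end.

(* e_j in R^m, with j counted from 1. *)
Definition stdvec (m j : nat) : 'cV[R]_m := \col_(i < m) (i.+1 == j)%:R.

Definition quasi_identity (m n : nat) (Q : 'M[R]_(m * n)) : Prop :=
  exists eps : 'rV[R]_m,
    (forall i, eps 0 i = 1 \/ eps 0 i = -1)
    /\ Q = diag_mx eps *t (1%:M : 'M[R]_n).

End Blocks.

Section MatrixPolynomials.
Variable F : fieldType.

Definition mxcoef (n : nat) (A : 'M[{poly F}]_n) (j : nat) : 'M[F]_n :=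
  map_mx (coefp j) A.

Definition mx_has_degree (n : nat) (A : 'M[{poly F}]_n) (m : nat) : Prop :=
  mxcoef A m <> 0 /\ forall j, (m < j)%N -> mxcoef A j = 0.

Definition regular (n : nat) (A : 'M[{poly F}]_n) : Prop := \det A != 0.

Definition skew_symmetric (n : nat) (P : 'M[{poly F}]_n) : Prop := P^T = - P.

Definition cmx (p q : nat) (B : 'M[F]_(p, q)) : 'M[{poly F}]_(p, q) :=
  map_mx polyC B.

(* M_i^A; with (k, r, D) in place of (m, n, A), N_i^D. *)
Definition elemA (m n : nat) (A : 'M[{poly F}]_n) (i : int) : 'M[F]_(m * n) :=
  elemmx m i (match i with
              | Posz j => - mxcoef A j
              | Negz j => mxcoef A j.+1
              end).

Definition elemA_tuple (m n : nat) (A : 'M[{poly F}]_n) (t : seq int)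
    : 'M[F]_(m * n) :=
  \big[mulmx/1%:M]_(i <- t) elemA m A i.

(* The pencil L_A; with (k, r, D) in place of (m, n, A), L_D. *)
Definition fiedler_pencil (m n : nat) (A : 'M[{poly F}]_n)
    (w cw tw z cz tz : seq int) : 'M[{poly F}]_(m * n) :=
  let M t := elemA_tuple m A t in
  cmx (M (rev tz)) *m cmx (M (rev tw))
    *m ('X *: cmx (M z) - cmx (M w))
    *m cmx (M cw) *m cmx (M tw) *m cmx (M cz) *m cmx (M tz).

Definition ratmx (p q : nat) (P : 'M[{poly F}]_(p, q))
    : 'M[{fraction {poly F}}]_(p, q) := map_mx (@tofrac _) P.

(* When A is regular, invmx is the inverse over the field of rational functions. *)
Definition transfer_function (n r : nat)
    (A : 'M[{poly F}]_n) (B : 'M[F]_(n, r)) (D : 'M[{poly F}]_r)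
    : 'M[{fraction {poly F}}]_r :=
  ratmx D + ratmx (cmx B^T) *m invmx (ratmx A) *m ratmx (cmx B).

Definition skew_realization (m k n r : nat) (G : 'M[{fraction {poly F}}]_r)
    (A : 'M[{poly F}]_n) (B : 'M[F]_(n, r)) (D : 'M[{poly F}]_r) : Prop :=
  [/\ regular A /\ mx_has_degree A m, mx_has_degree D k,
      skew_symmetric A, skew_symmetric D & G = transfer_function A B D].

Definition system_matrix (n r : nat)
    (A : 'M[{poly F}]_n) (B : 'M[F]_(n, r)) (D : 'M[{poly F}]_r)
    : 'M[{poly F}]_(n + r) :=
  block_mx A (- cmx B) (cmx B^T) D.

(* A square polynomial matrix is unimodular when it is in unitmx over {poly F},
   i.e. when its determinant is a nonzero constant.  The equality e only serves to
   type the right-hand side; it holds as soon as m, k > 0. *)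
Definition rosenbrock_linearization (m k n r : nat)
    (G : 'M[{fraction {poly F}}]_r)
    (A : 'M[{poly F}]_n) (B : 'M[F]_(n, r)) (D : 'M[{poly F}]_r)
    (LL : 'M[{poly F}]_(m * n + k * r)) : Prop :=
  G = transfer_function A B D /\
  exists (e : (m.-1 * n + (n + r) + k.-1 * r = m * n + k * r)%N)
         (UA VA : 'M[{poly F}]_(m * n)) (UD VD : 'M[{poly F}]_(k * r)),
    [/\ UA \in unitmx, VA \in unitmx, UD \in unitmx, VD \in unitmx
      & block_mx UA 0 0 UD *m LL *m block_mx VA 0 0 VD
        = castmx (e, e)
            (block_mx (block_mx 1%:M 0 0 (system_matrix A B D)) 0 0 1%:M)].

(* [QA LA, e_a e_b^T (x) (-B); e_c e_d^T (x) B^T, QD LD]. *)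
Definition bordered_pencil (m k n r : nat)
    (QA : 'M[F]_(m * n)) (LA : 'M[{poly F}]_(m * n))
    (QD : 'M[F]_(k * r)) (LD : 'M[{poly F}]_(k * r))
    (B : 'M[F]_(n, r)) (a b c d : nat) : 'M[{poly F}]_(m * n + k * r) :=
  block_mx (cmx QA *m LA)
           (cmx ((stdvec F m a *m (stdvec F k b)^T) *t (- B)))
           (cmx ((stdvec F k c *m (stdvec F m d)^T) *t B^T))
           (cmx QD *m LD).

End MatrixPolynomials.

(* Main.v *)
From HB Require Import structures.
Require Import Defs.
From mathcomp Require Import all_boot all_order all_algebra.
From mathcomp Require Import reals complex mxtens zify.
Import GRing.Theory.

(** Label the block rows and columns of the A-part by their distance to the
    last one. For s > 0 the factor M_s(P) then acts on the labels s and s-1 by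
    the blocks [[P, I], [I, 0]], M_0(P) multiplies label 0 by P, and a factor of
    index s - m acts in the same way on the reversed labels m-1-s and m-s.

    Factors acting on disjoint labels commute. Moving them around turns L_A into
    a congruence M_rev(t) (x U - V) M_t, where t lists the odd indices of c_w,
    the indices of c_z outside its rev_c part, and then t_w and t_z
    ([fiedler_pencil_mcongs]), and where U and V depend only on m, on the
    coefficients of A and on e = m - 1 - Ind(z), which is even. Among the labels
    at most e, x U - V is block tridiagonal, with diagonal blocks
    x A_(i+1) + A_i at even labels and 0 at odd ones, and off-diagonal blocks
    alternating between x I and - I. At the labels from e on, the part of c_z
    that comes from rev_c produces a Hankel corner ([revc_hankel]).

    Skew-symmetry. Give a sign to each label. U and V are skew-symmetric up to
    the signs that are minus exactly at the odd labels below e. A factor with a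
    skew-symmetric block that acts on a minus label u and a plus label v
    exchanges these two signs and preserves skew-symmetry up to signs; M_0
    and M_(-m), which act on a single label, preserve it by turning that label
    from minus into plus ([skewf_mcong]). So the
    congruence by M_t is harmless as long as every factor of t meets the right
    signs. This is what the type-1 condition says: for the tuple reached so far,
    the sign at s is plus iff s is maximal or s+1 precedes s
    ([right_index1_inversion_at], [hops_valid]). The signs after the last factor
    form Q_A.

    Uniqueness. Two sign functions that both make a matrix skew-symmetric agree
    up to a factor that is constant along its nonzero blocks. In U and V enough
    blocks are known to be nonzero, being I or A_m, to connect all the labels;
    the pattern of these blocks is carried along by each congruence ([spine],
    [spine_mcong], [linked_UV]).

    Linearization. An explicit block column whose entry at label 0 is I is sent
    by x U - V to A at label 0 and 0 elsewhere ([pencil_factor_col]). By skew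
    symmetry its transpose works on the other side, so one congruence splits off
    A. The remaining matrix is unimodular, being triangular with invertible
    diagonal after a permutation of its columns and a reordering of the labels
    ([cleared_unit]). The congruence by M_t carries label 0 to the label g
    obtained by following the factors that act on the current label; reading t
    from left to right, this matches 1, 2, 3 and so on greedily, so
    g = i_0 = c_0 ([hops_track], [inversions0_consecutions0]). As g has a plus
    sign, Q_A does not alter the border, and reducing the two sides separately
    brings B to the corner of the system matrix ([rosenbrock_bordered]). *)

Set Implicit Arguments.
Unset Strict Implicit.
Unset Printing Implicit Defensive.

Local Open Scope ring_scope.

(** * Index tuples *)

Section IndexTuples.
Local Open Scope nat_scope.

(** Interchanging entries at distance more than 1 does not affect the subtuple
    of the entries x and x+1, and this subtuple is all that the type-1
    condition sees. *)
Definition adj (x : nat) : pred nat := fun y => (y == x) || (y == x.+1).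

Definition inversion_at (g : seq nat) (x : nat) : bool :=
  filter (adj x) g == [:: x.+1; x].

(** Two interchanged entries cannot both lie in {x, x+1}. *)
Lemma commutes_filter g g' x :
  commutes_to g g' -> filter (adj x) g = filter (adj x) g'.
Proof.
elim=> // s t i j u hij _ <-; rewrite !filter_cat /=.
have : ~~ (adj x i && adj x j) by rewrite /adj; lia.
by case: (adj x i); case: (adj x j).
Qed.

Lemma commutes_inversion_at g g' : commutes_to g g' -> inversion_at g =1 inversion_at g'.
Proof. by move=> h x; rewrite /inversion_at (commutes_filter x h). Qed.

Lemma commutes_perm g g' : commutes_to g g' -> perm_eq g g'.
Proof.
elim=> // s t i j u _ _; apply: perm_trans.
rewrite perm_cat2l -![_ :: _ :: _]/([:: _] ++ [:: _] ++ _).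
by rewrite perm_catCA perm_refl.
Qed.

Lemma commutes_rev g g' : commutes_to g g' -> commutes_to (rev g) (rev g').
Proof.
elim=> [s|s t i j u hij _]; first exact: CommRefl.
rewrite !rev_cat !rev_cons -!cats1 -!catA /= => h.
by apply: CommSwap h; rewrite orbC.
Qed.

Lemma inversion_at_rev g x : inversion_at (rev g) x = (filter (adj x) g == [:: x; x.+1]).
Proof. by rewrite /inversion_at filter_rev -(inj_eq (can_inj revK)) revK. Qed.

Lemma mem_str a b x : (x \in str a b) = (a <= x <= b).
Proof. by rewrite mem_iota; lia. Qed.

Lemma filter_adjl x K : uniq K -> x \notin K -> x.+1 \in K ->
  filter (adj x) K = [:: x.+1].
Proof.
move=> uK xK x1K; rewrite -(filter_pred1_uniq uK x1K).
by apply: eq_in_filter => y yK; rewrite /adj /=; case: eqP yK xK => [->->|].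
Qed.

Lemma filter_adjr x K : uniq K -> x \in K -> x.+1 \notin K ->
  filter (adj x) K = [:: x].
Proof.
move=> uK xK x1K; rewrite -(filter_pred1_uniq uK xK).
by apply: eq_in_filter => y yK; rewrite /adj /= orbC; case: eqP yK x1K => [->->|].
Qed.

Lemma filter_adj0 x K : x \notin K -> x.+1 \notin K -> filter (adj x) K = [::].
Proof.
move=> xK x1K; rewrite -(filter_pred0 K); apply: eq_in_filter => y yK.
by rewrite /adj; case: eqP yK xK => [->->//|_]; case: eqP x1K => // -> /negbTE->.
Qed.

Lemma strs_cat bs bs' : strs (bs ++ bs') = strs bs ++ strs bs'.
Proof. by rewrite /strs map_cat flatten_cat. Qed.

Lemma mem_strs bs x : (x \in strs bs) = has (fun b => b.1 <= x <= b.2) bs.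
Proof.
elim: bs => // b bs IH; rewrite /= -IH -mem_str.
by rewrite -[strs _]/(str b.1 b.2 ++ strs bs) mem_cat.
Qed.

(** A type-1 step moves s to the right, from the head of its string (s : t) to
    the end of the next one, which ends in s-1: s jumps over a block K that
    contains its neighbours, and nothing else changes. *)
Lemma zr_strings_move p bs s bs' :
  sorted (fun b b' => b'.2 < b.2) bs -> all (fun b => b.1 <= b.2 <= p) bs ->
  perm_eq (strs bs) (iota 0 p.+1) -> zr_strings bs s bs' ->
  exists H K Lo,
    [/\ strs bs = H ++ s :: K ++ Lo, strs bs' = H ++ K ++ s :: Lo,
        s.+1 \in K & 0 < s -> s.-1 \in K].
Proof.
move=> hsort hall hps hz.
have us : uniq (strs bs) by rewrite (perm_uniq hps) iota_uniq.
case: hz hsort hall us hps => [hi lo {}s t c d s0 st|hi t t0].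
  rewrite sorted_pairwise; last by move=> ? ? ? /=; lia.
  rewrite pairwise_cat => /and3P[/allrelP hhi _ /=].
  move=> /and3P[/andP[dt _] /allP hlo _].
  rewrite all_cat /= => /andP[_ /and3P[/andP[_ tp] /andP[cd _] _]].
  rewrite !strs_cat.
  have -> : forall b b' l, strs [:: b, b' & l]
    = str b.1 b.2 ++ str b'.1 b'.2 ++ strs l by [].
  have -> : forall b b' l, strs [:: b, b' & l]
    = str b.1 b.2 ++ str b'.1 b'.2 ++ strs l by [].
  move=> us hps /=.
  have lt_ds : d < s.
    rewrite ltnNge; apply/negP => sd.
    move: us; rewrite cat_uniq => /and3P[_ _].
    rewrite cat_uniq => /and3P[_ /hasPn/(_ d)].
    rewrite mem_cat !mem_str cd leqnn => /(_ isT) /negP[].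
    by rewrite /=; lia.
  (* the strings partition {0, ..., p}, so s-1 lies in one of them, and it cannot
     be in a string before (s : t) or after (c : d), since the last entries decrease *)
  have ds : d = s.-1.
    have : s.-1 \in strs hi ++ str s t ++ str c d ++ strs lo.
      by rewrite (perm_mem hps) in_cons mem_iota; lia.
    rewrite !mem_cat !mem_str !mem_strs.
    case/or4P => [/hasP[[a b] /= abhi hab]|||/hasP[[a b] ab /=]]; try lia.
      have := hhi _ _ abhi (mem_head _ _) => /= tb.
      move: us; rewrite cat_uniq => /and3P[_ /hasPn/(_ s)].
      rewrite mem_cat mem_str leqnn ltnW //= => /(_ isT).
      by rewrite mem_strs => /hasPn/(_ _ abhi) /=; lia.
    by have := hlo _ ab => /=; lia.
  exists (strs hi), (str s.+1 t ++ str c d), (strs lo); split.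
  - rewrite /str subSn ?(ltnW st) //= -?catA //.
  - congr (_ ++ _); rewrite -!catA; congr (_ ++ _).
    rewrite /str ds; have -> : s.+1 - c = (s.-1.+1 - c) + 1 by lia.
    by rewrite iotaD -catA /=; congr (_ ++ _); congr (_ :: _); lia.
  - by rewrite mem_cat mem_str leqnn st.
  - by rewrite mem_cat !mem_str; lia.
move=> _ _ us _; rewrite !strs_cat.
exists (strs hi), (str 1 t), [::]; split => //.
  by congr (_ ++ _); rewrite /strs /str /= subn1.
by rewrite mem_str.
Qed.

(** The effect of a type-1 step on the inversions: s precedes s+1 before the step
    and follows it afterwards, and the opposite holds for the pair s-1, s. The
    signs of the labels change in the same way under the factor of index s
    (see [sign_step]), which is why type-1 tuples keep the signs valid. *)
Lemma right_index1_inversion_at p alpha s beta :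
  perm_eq alpha (iota 0 p.+1) -> right_index1 p alpha s beta ->
  [/\ s < p, perm_eq beta (iota 0 p.+1), ~~ inversion_at alpha s,
      0 < s -> inversion_at alpha s.-1 &
      forall x,
        inversion_at beta x = (x == s) || (x.+1 != s) && inversion_at alpha x].
Proof.
move=> hp [ltsp [bs [bs' [[hsort hall hcom] hz ->]]]].
have hps : perm_eq (strs bs) (iota 0 p.+1).
  by rewrite (perm_trans _ hp) // perm_sym; apply: commutes_perm.
have [H [K [Lo [e1 e2 hK hK0]]]] := zr_strings_move hsort hall hps hz.
have us : uniq (strs bs) by rewrite (perm_uniq hps) iota_uniq.
have eqs : perm_eq (strs bs') (strs bs).
  by rewrite e1 e2 perm_cat2l perm_sym -cat1s perm_catCA.
have disj y : y \in s :: K -> (y \notin H) && (y \notin Lo).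
  move=> yK; move: us; rewrite e1 cat_uniq => /and3P[_ /hasPn h1].
  rewrite -[s :: _]/((s :: K) ++ Lo) cat_uniq => /and3P[_ /hasPn h2 _].
  apply/andP; split; first by apply: h1; rewrite -cat_cons mem_cat yK.
  by apply/negP => /h2; rewrite /= yK.
have [uK sK] : uniq K /\ s \notin K.
  move: us; rewrite e1 cat_uniq => /and3P[_ _].
  by rewrite /= mem_cat negb_or cat_uniq => /andP[/andP[-> _] /andP[-> _]].
have fs : filter (adj s) (strs bs) = [:: s; s.+1] /\
          filter (adj s) (strs bs') = [:: s.+1; s].
  have /andP[h1 h2] := disj s (mem_head _ _).
  have /andP[h3 h4] : (s.+1 \notin H) && (s.+1 \notin Lo).
    by apply: disj; rewrite in_cons hK orbT.
  rewrite e1 e2 !filter_cat /= !filter_cat.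
  by rewrite (filter_adjl uK sK hK) /adj eqxx /= !filter_adj0.
have fs1 x : x.+1 = s -> filter (adj x) (strs bs) = [:: x.+1; x] /\
          filter (adj x) (strs bs') = [:: x; x.+1].
  move=> xs; have xK : x \in K by move: hK0; rewrite -xs; apply.
  have /andP[h1 h2] := disj s (mem_head _ _).
  have /andP[h3 h4] : (x \notin H) && (x \notin Lo).
    by apply: disj; rewrite in_cons xK orbT.
  rewrite -xs in h1 h2 sK *.
  rewrite e1 e2 -xs !filter_cat /= filter_cat (filter_adjr uK xK sK).
  by rewrite /adj eqxx orbT /= !filter_adj0.
split=> // [||s0|x].
- by rewrite (perm_trans eqs).
- by rewrite (commutes_inversion_at hcom) /inversion_at (proj1 fs); apply/eqP => -[]; lia.
- by rewrite (commutes_inversion_at hcom) /inversion_at (proj1 (fs1 _ _)) prednK.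
rewrite (commutes_inversion_at hcom) /inversion_at.
have [->|xs] := eqVneq x s; first by rewrite (proj2 fs) eqxx.
have [x1s|x1s] /= := eqVneq x.+1 s.
  by rewrite (proj2 (fs1 _ x1s)); apply/eqP => -[]; lia.
have nadj : adj x s = false by rewrite /adj; lia.
by rewrite e1 e2 !filter_cat /= filter_cat nadj.
Qed.

Lemma pairs_rec q k :
  [seq (q + i.*2.+1, q + i.*2.+2) | i <- rev (iota 0 k.+1)] =
  (q + k.*2.+1, q + k.*2.+2) ::
    [seq (q + i.*2.+1, q + i.*2.+2) | i <- rev (iota 0 k)].
Proof. by rewrite -addn1 iotaD rev_cat. Qed.

Lemma strs_pairs_rec q n :
  strs [seq (q + i.*2.+1, q + i.*2.+2) | i <- rev (iota 0 n.+1)] =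
  [:: q + n.*2.+1, q + n.*2.+2
    & strs [seq (q + i.*2.+1, q + i.*2.+2) | i <- rev (iota 0 n)]].
Proof.
rewrite pairs_rec -cat1s strs_cat /strs /= cats0 /str.
have -> : (q + n.*2.+2).+1 - (q + n.*2.+1) = 2 by lia.
by rewrite /= (addnS q n.*2.+1).
Qed.

(** In the reversal of (p-1:p, ..., q+1:q+2, 0:q) every string is decreasing and
    the strings are in increasing order; so x+1 precedes x exactly when both
    lie in one string. *)
Lemma inversion_at_rev_admissible p q g x :
  admissible p q g -> x < p -> inversion_at (rev g) x = (x < q) || odd (x - q).
Proof.
move=> [_ leqp pq_even [_ _ hcom]] ltxp.
have [k pE] : exists k, p = q + k.*2.
  exists (p - q)./2; have := odd_double_half (p - q).
  by rewrite (negbTE pq_even); lia.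
rewrite inversion_at_rev (commutes_filter _ hcom) {hcom pq_even leqp} /adm_strings.
have -> : (p - q)./2 = k by rewrite pE; lia.
rewrite strs_cat filter_cat.
have -> : strs [:: (0, q)] = iota 0 q.+1 by rewrite /strs /= cats0.
set I := iota 0 q.+1.
have I_out y : q < y -> y \notin I by rewrite mem_iota; lia.
set f := fun k => strs [seq (q + i.*2.+1, q + i.*2.+2) | i <- rev (iota 0 k)].
have fS n : f n.+1 = [:: q + n.*2.+1, q + n.*2.+2 & f n].
  exact: strs_pairs_rec.
rewrite -/(f k).
have f_out n y : (y <= q) || (q + n.*2 < y) -> y \notin f n.
  elim: n => [//|n IH]; rewrite fS !in_cons !negb_or => h; rewrite IH; lia.
case: (ltnP x q) => [ltxq|leqx].
  rewrite filter_adj0; [|by rewrite f_out // ltnW|by rewrite f_out // ltxq].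
  have -> : I = iota 0 x ++ [:: x; x.+1] ++ iota x.+2 (q.+1 - x.+2).
    rewrite /I; have {1}-> : q.+1 = x + (2 + (q.+1 - x.+2)) by lia.
    by rewrite iotaD iotaD /= addn2.
  rewrite !filter_cat /= /adj !eqxx orbT.
  by rewrite !filter_adj0 ?mem_iota /= ?eqxx ?ltxq //; lia.
clearbody I; rewrite -filter_cat orFb; move: ltxp; rewrite {}pE => {p}.
elim: k => [|k IH] hx; first lia.
rewrite fS /=; case: (ltngtP x (q + k.*2)) => [hxk|hxk|->].
- rewrite -IH // (_ : adj x _ = false) 1?(_ : adj x _ = false) // /adj; lia.
- have -> : x = q + k.*2.+1 by lia.
  rewrite (addnS q k.*2.+1) addKn /= odd_double.
  rewrite [filter _ _]filter_adj0 ?mem_cat ?negb_or ?f_out ?I_out; try lia.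
  by rewrite /adj !eqxx orbT eqxx.
- rewrite (addnS q k.*2) addKn odd_double.
  have -> : adj (q + k.*2) (q + k.*2).+1 by rewrite /adj eqxx orbT.
  by apply/eqP => -[]; lia.
Qed.

(** Scans g and looks for k, k+1, k+2, ... in turn; the result is the first
    value that is not found. Being recursive in g, it replaces the maxima over
    subtuples by which consecutions and inversions are defined. *)
Definition greedy (k : nat) (g : seq nat) : nat :=
  foldl (fun k s => if s == k then k.+1 else k) k g.

#[global] Arguments greedy : simpl never.

Lemma greedy_cat k g g' : greedy k (g ++ g') = greedy (greedy k g) g'.
Proof. exact: foldl_cat. Qed.

Lemma greedy_commutes k g g' : commutes_to g g' -> greedy k g = greedy k g'.
Proof.
move=> hg; elim: hg k => // s t i j u hij _ IH k; rewrite -IH !greedy_cat.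
move: (greedy k s) => a; rewrite /greedy /=; congr (foldl _ _ _).
by case: (eqVneq i a) => ?; case: (eqVneq j a) => ?; do ?case: eqP => ?; lia.
Qed.

Lemma greedy_cons k x g : greedy k (x :: g) = greedy (if x == k then k.+1 else k) g.
Proof. by []. Qed.

Lemma leq_greedy k g : k <= greedy k g.
Proof.
elim: g k => // x g IH k; rewrite greedy_cons; apply: leq_trans (IH _).
by case: ifP.
Qed.

(** The leftmost embedding is the best one. *)
Lemma subseq_greedy k s g : subseq (iota k s) g = (k + s <= greedy k g).
Proof.
elim: g k s => [|x g IH] k s.
  case: s => [|s]; first by rewrite addn0 leqnn.
  by apply/esym/negbTE; rewrite -ltnNge addnS ltnS leq_addr.
case: s => [|s]; first by rewrite sub0seq addn0 leq_greedy.
rewrite greedy_cons /= eq_sym; case: eqVneq => [_|ne]; first by rewrite IH addSnnS.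
exact: (IH k s.+1).
Qed.

Lemma leq_greedy_size k g : greedy k g <= k + size g.
Proof.
elim: g k => [|x g IH] k; first by rewrite addn0.
rewrite greedy_cons (leq_trans (IH _)) //=; case: ifP => _; lia.
Qed.

Lemma max_greedy g : \max_(s < size g | s < greedy 0 g) s = (greedy 0 g).-1.
Proof.
apply/eqP; rewrite eqn_leq; apply/andP; split.
  by apply/bigmax_leqP => s; lia.
have := leq_greedy_size 0 g; case E : (greedy 0 g) => [|k] //= hk.
by rewrite (bigD1 (Ordinal hk)) //= leq_maxl.
Qed.

Lemma consecutions0_greedy g : consecutions0 g = (greedy 0 g).-1.
Proof.
by rewrite -max_greedy; apply: eq_bigl => s; rewrite subseq_greedy.
Qed.

Lemma inversions0_greedy g : inversions0 g = (greedy 0 (rev g)).-1.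
Proof.
rewrite -max_greedy size_rev; apply: eq_bigl => s.
by rewrite -subseq_rev revK subseq_greedy.
Qed.

Lemma symcompl_rec q n :
  [seq q + i.*2.+1 | i <- rev (iota 0 n.+1)] =
  q + n.*2.+1 :: [seq q + i.*2.+1 | i <- rev (iota 0 n)].
Proof. by rewrite -addn1 iotaD rev_cat. Qed.

(** Up to commutation w is (h-1, h, ..., 1, 2, 0), where 1 occurs only before 0.
    Its reversal is (0, 2, 1, ..., h, h-1), in which, for h > 0, 0 and 1 are
    found but not 2, since 2 precedes 1; scanning c_w = (h-1, ..., 3, 1) from 1
    has the same result. *)
Lemma greedy_admissible0 h w : admissible h 0 w ->
  greedy 0 w = 1 /\ greedy 0 (rev w) = greedy 1 (symcompl h 0).
Proof.
move=> [_ _ _ [_ _ hcom]].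
rewrite (greedy_commutes _ hcom) (greedy_commutes _ (commutes_rev hcom)).
rewrite /adm_strings /symcompl subn0 cats0 strs_cat.
elim: (h./2) => {hcom} [//|n [IH1 IH2]].
rewrite strs_pairs_rec symcompl_rec !add0n !cat_cons !greedy_cons /= IH1.
split=> //; rewrite !rev_cons -!cats1 -catA greedy_cat IH2 !greedy_cons.
case: n {IH1 IH2} => [//|n].
suff -> : greedy 1 [seq 0 + i.*2.+1 | i <- rev (iota 0 n.+1)] = 2.
  by rewrite !doubleS.
by elim: n => // n IH; rewrite symcompl_rec greedy_cons add0n doubleS.
Qed.

(** Both numbers are obtained by scanning c_w and then t_w, starting from 1. This
    is why the two border blocks of the pencil sit at transposed positions. *)
Lemma inversions0_consecutions0 h w t : admissible h 0 w ->
  inversions0 (rev t ++ w) = (greedy 1 (symcompl h 0 ++ t)).-1 /\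
  consecutions0 (w ++ symcompl h 0 ++ t) = (greedy 1 (symcompl h 0 ++ t)).-1.
Proof.
move=> /greedy_admissible0[h1 h2].
rewrite inversions0_greedy consecutions0_greedy rev_cat revK.
by rewrite (greedy_cat _ (rev w)) (greedy_cat _ w) h1 h2 -greedy_cat.
Qed.

End IndexTuples.

(** * Block matrices indexed by labels *)

HB.instance Definition _ (T : pzRingType) (N : nat) :=
  Monoid.isLaw.Build 'M[T]_N 1%:M (@mulmx T N N N)
    (@mulmxA T N N N N) (@mul1mx T N N) (@mulmx1 T N N).

Section BlockMatrices.
Variables (S : comUnitRingType) (m n : nat).
Implicit Types (f g : nat -> nat -> 'M[S]_n) (u v : nat).

(** A block matrix given by a function of the labels. Labels count from the last
    block row and column, hence the reversal. Functions on nat rather than on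
    ordinals keep the label arithmetic within linear arithmetic; their values at
    labels from m on are irrelevant. *)
Definition bmx f : 'M[S]_(m * n) := blocks (fun a b => f (rev_ord a) (rev_ord b)).

Definition bid (i j : nat) : 'M[S]_n := if i == j then 1%:M else 0.

Lemma blocksE (F : 'I_m -> 'I_m -> 'M[S]_n) a b i j :
  blocks F (mxtens_index (a, i)) (mxtens_index (b, j)) = F a b i j.
Proof.
rewrite /blocks summxE (bigD1 a) //= summxE (bigD1 b) //= tensmxE.
rewrite mxE !eqxx mul1r big1 => [|b' nb]; last first.
  by rewrite tensmxE mxE eqxx [b == b']eq_sym (negbTE nb) mul0r.
rewrite big1 ?addr0 // => a' na; rewrite summxE big1 // => b' _.
by rewrite tensmxE mxE [a == a']eq_sym (negbTE na) mul0r.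
Qed.

Lemma bmxE f (a b : 'I_m) i j :
  bmx f (mxtens_index (rev_ord a, i)) (mxtens_index (rev_ord b, j)) = f a b i j.
Proof. by rewrite blocksE !rev_ordK. Qed.

Lemma bmx_matrixP (A B : 'M[S]_(m * n)) :
  (forall (a b : 'I_m) i j,
     A (mxtens_index (rev_ord a, i)) (mxtens_index (rev_ord b, j)) =
     B (mxtens_index (rev_ord a, i)) (mxtens_index (rev_ord b, j))) -> A = B.
Proof.
move=> h; apply/matrixP => x y.
case: (mxtens_indexP x) => a i; case: (mxtens_indexP y) => b j.
by rewrite -[a]rev_ordK -[b]rev_ordK.
Qed.

Lemma eq_bmx f g :
  (forall i j, (i < m)%N -> (j < m)%N -> f i j = g i j) -> bmx f = bmx g.
Proof. by move=> h; apply: bmx_matrixP => a b i j; rewrite !bmxE h. Qed.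

Lemma bmx_inj f g : bmx f = bmx g ->
  forall i j, (i < m)%N -> (j < m)%N -> f i j = g i j.
Proof.
move=> h i j im jm; apply/matrixP => x y.
by rewrite -(bmxE f (Ordinal im) (Ordinal jm)) h bmxE.
Qed.

Lemma bmxM f g :
  bmx f *m bmx g = bmx (fun i j => \sum_(k < m) f i k *m g k j).
Proof.
apply: bmx_matrixP => a b i j; rewrite bmxE summxE.
transitivity (\sum_(k < m) \sum_x f a k i x * g k b x j); last first.
  by apply: eq_bigr => k _; rewrite mxE.
rewrite mxE pair_bigA.
rewrite (reindex (fun p : 'I_m * 'I_n => mxtens_index (rev_ord p.1, p.2))) /=.
  by apply: eq_bigr => -[k x] _ /=; rewrite !bmxE.
exists (fun k => (rev_ord (mxtens_unindex k).1, (mxtens_unindex k).2)) => k _.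
  by rewrite mxtens_indexK rev_ordK; case: k.
by rewrite rev_ordK -surjective_pairing mxtens_unindexK.
Qed.

Lemma bmx1 : bmx bid = 1%:M.
Proof.
apply: bmx_matrixP => a b i j; rewrite bmxE mxE (can_eq (@mxtens_indexK _ _)).
rewrite xpair_eqE (can_eq rev_ordK) /bid -val_eqE.
by case: eqP => _ /=; rewrite ?mxE.
Qed.

Lemma bmxT f : (bmx f)^T = bmx (fun i j => (f j i)^T).
Proof. by apply: bmx_matrixP => a b i j; rewrite mxE !bmxE mxE. Qed.

Lemma bmxB f g : bmx f - bmx g = bmx (fun i j => f i j - g i j).
Proof. by apply: bmx_matrixP => a b i j; rewrite !mxE !bmxE !mxE. Qed.

Lemma bmxN f : - bmx f = bmx (fun i j => - f i j).
Proof. by apply: bmx_matrixP => a b i j; rewrite !mxE !bmxE !mxE. Qed.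

Lemma bmxZ c f : c *: bmx f = bmx (fun i j => c *: f i j).
Proof. by apply: bmx_matrixP => a b i j; rewrite !mxE !bmxE !mxE. Qed.

Lemma sum_bid a j g : (a < m)%N -> \sum_(k < m) bid a k *m g k j = g a j.
Proof.
move=> im; rewrite (bigD1 (Ordinal im)) //= /bid eqxx mul1mx big1 ?addr0 // => k nk.
by rewrite eq_sym -[a]/(nat_of_ord (Ordinal im)) val_eqE (negbTE nk) mul0mx.
Qed.

Lemma sum_bidr i j g : (j < m)%N -> \sum_(k < m) g i k *m bid k j = g i j.
Proof.
move=> im; rewrite (bigD1 (Ordinal im)) //= /bid eqxx mulmx1 big1 ?addr0 // => k nk.
by rewrite -[j]/(nat_of_ord (Ordinal im)) val_eqE (negbTE nk) mulmx0.
Qed.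

(** An elementary factor: with column label v it acts on the labels u, v by
    [[P, I], [I, 0]], and without one it multiplies label u by P. *)
Record move := Move { mrow : nat; mcol : option nat; mblk : 'M[S]_n }.
Implicit Type x : move.

(** Left multiplication by a factor, read off as a row operation; [ract] is the
    column operation given by right multiplication. *)
Definition lact x f (i j : nat) :=
  if i == mrow x then
    mblk x *m f (mrow x) j + (if mcol x is Some v then f v j else 0)
  else if Some i == mcol x then f (mrow x) j else f i j.

Definition ract x f (i j : nat) :=
  if j == mrow x then
    f i (mrow x) *m mblk x + (if mcol x is Some v then f i v else 0)
  else if Some j == mcol x then f i (mrow x) else f i j.

Definition wf x :=
  (mrow x < m)%N && (if mcol x is Some v then (v < m)%N && (v != mrow x) else true).

Definition emx x := bmx (lact x bid).

Lemma emx_lact x f : wf x -> emx x *m bmx f = bmx (lact x f).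
Proof.
case: x => u ov P /andP[/= um vm]; rewrite bmxM; apply: eq_bmx => i j im jm.
rewrite /lact /=; case: (i == u).
  rewrite -(sum_bid j f um) mulmx_sumr; case: ov vm => [v /andP[vm _]|_].
    by rewrite -(sum_bid j f vm) -big_split; apply: eq_bigr => k _;
       rewrite mulmxDl mulmxA.
  by rewrite addr0; apply: eq_bigr => k _; rewrite addr0 mulmxA.
by case: (Some i == ov); rewrite sum_bid.
Qed.

(** A factor has a symmetric pattern with P on the diagonal, so applying it to the
    identity by rows or by columns gives the same matrix. *)
Lemma lact_bid x : wf x -> forall i j, lact x bid i j = ract x bid i j.
Proof.
pose simp := (mulmx1, mul1mx, mulmx0, mul0mx, addr0, add0r).
case: x => u [v|] P /andP[/= um]; last first.
  move=> _ i j; rewrite /lact /ract /bid /= (eq_sym u j).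
  by have [iu|/negbTE iu] := eqVneq i u; have [ju|/negbTE ju] := eqVneq j u;
     rewrite ?iu ?ju ?eqxx ?(eq_sym u j) ?iu ?ju ?simp.
case/andP=> _ vu i j; rewrite /lact /ract /bid /=.
have E k : (Some k == Some v) = (k == v) by [].
rewrite !E.
have [iu|/negbTE iu] := eqVneq i u; have [ju|/negbTE ju] := eqVneq j u.
- by rewrite iu ju mulmx1 mul1mx (eq_sym u v).
- by rewrite mulmx0 add0r iu (eq_sym v) (eq_sym u) ju; case: (j == v).
- by rewrite mul0mx add0r ju iu.
have [iv|/negbTE iv] := eqVneq i v; have [jv|/negbTE jv] := eqVneq j v => //.
- by rewrite iv eq_sym jv.
- by rewrite jv iv.
Qed.

Lemma emx_ract x f : wf x -> bmx f *m emx x = bmx (ract x f).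
Proof.
move=> wx; rewrite /emx (eq_bmx (fun i j _ _ => lact_bid wx i j)).
case: x wx => u ov P /andP[/= um vm]; rewrite bmxM; apply: eq_bmx => i j im jm.
rewrite /ract /=; case: (j == u).
  rewrite -(sum_bidr i f um) mulmx_suml; case: ov vm => [v /andP[vm _]|_].
    by rewrite -(sum_bidr i f vm) -big_split; apply: eq_bigr => k _;
       rewrite mulmxDr mulmxA.
  by rewrite addr0; apply: eq_bigr => k _; rewrite addr0 mulmxA.
by case: (Some j == ov); rewrite sum_bidr.
Qed.

(** The inverse of [[P, I], [I, 0]] is [[0, I], [I, - P]], a factor of the same
    form with the two labels exchanged. *)
Definition invmove x :=
  if mcol x is Some v then Move v (Some (mrow x)) (- mblk x)
  else Move (mrow x) None (invmx (mblk x)).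

Lemma emx_unit x : wf x -> (mcol x = None -> mblk x \in unitmx) -> emx x \in unitmx.
Proof.
move=> wx hx; suff : emx x *m emx (invmove x) = 1%:M by case/mulmx1_unit.
rewrite [emx (invmove x)]/emx emx_lact // -bmx1; apply: eq_bmx => i j _ _.
case: x wx hx => u [v|] P /andP[/= um].
  case/andP=> _ vu _; rewrite /lact /=.
  have E k w : (Some k == Some w) = (k == w) by [].
  rewrite !E !eqxx (eq_sym u v) (negbTE vu).
  have [->|iu] := eqVneq i u; first by rewrite mulNmx addrA subrr add0r.
  by case: eqP => // ->.
move=> _ /(_ erefl) uP; rewrite /lact /= eqxx !addr0.
by case: eqP => // ->; rewrite mulmxA mulmxV // mul1mx.
Qed.

(** Standard vectors count from 1 and from the top, so e_(m-g) is the one at label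
    g. *)
Definition ecol (g : nat) : 'M[S]_(m * n, 1 * n) := stdvec S m (m - g) *t 1%:M.

Lemma ecolE (g : nat) (a : 'I_m) i j :
  ecol g (mxtens_index (rev_ord a, i)) (mxtens_index (ord0, j)) =
  ((nat_of_ord a == g) && (i == j))%:R.
Proof.
rewrite tensmxE !mxE -mulnb natrM; congr (_%:R * _); congr nat_of_bool.
by have := ltn_ord a; rewrite /=; lia.
Qed.

Lemma bmx_ecolE f (g : nat) (a : 'I_m) i j : (g < m)%N ->
  (bmx f *m ecol g) (mxtens_index (rev_ord a, i)) (mxtens_index (ord0, j)) =
  f a g i j.
Proof.
move=> gm; rewrite mxE.
rewrite (bigD1 (mxtens_index (rev_ord (Ordinal gm), j))) //= bmxE ecolE !eqxx mulr1.
rewrite big1 ?addr0 // => x; case: (mxtens_indexP x) => b k.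
rewrite -[b]rev_ordK ecolE (can_eq (@mxtens_indexK _ _)) xpair_eqE.
by rewrite (can_eq rev_ordK) -val_eqE /= => /negbTE ->; rewrite mulr0.
Qed.

Lemma bmx_ecol f (g g' : nat) : (g < m)%N -> (forall a, (a < m)%N -> f a g = bid a g') ->
  bmx f *m ecol g = ecol g'.
Proof.
move=> gm hf; apply/matrixP => x y.
case: (mxtens_indexP x) => a i; case: (mxtens_indexP y) => b j.
rewrite -[a]rev_ordK [b]ord1 bmx_ecolE // hf // ecolE /bid.
by case: eqP => _ /=; rewrite ?mxE.
Qed.

(** The factor of index s for a given numbering of the labels: the identity for
    the nonnegative indices, the reversal for the negative ones. Both families
    are treated at once in this way. *)
Definition smove (lab : nat -> nat) (P : 'M[S]_n) (s : nat) : move :=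
  Move (lab s) (if s is s'.+1 then Some (lab s') else None) P.

Lemma elemmx_pos s P : (s < m)%N -> elemmx m s P = emx (smove id P s).
Proof.
move=> sm; apply: bmx_matrixP => a b i j; rewrite bmxE.
have am := ltn_ord a; have bm := ltn_ord b.
case: s sm => [|s] sm; rewrite /elemmx blocksE; congr ((_ : 'M_n) i j);
  rewrite -?val_eqE /lact /bid /=.
  have -> : (m - a.+1 == m - b.+1)%N = (a == b :> nat) by lia.
  have -> : (m - a.+1 == m.-1)%N = (a == 0%N :> nat) by lia.
  rewrite addr0; case: (eqVneq (a : nat) 0%N) => [->|//].
  by case: eqP; rewrite ?mulmx1 ?mulmx0.
have E c : (c < m)%N -> ((m - c.+1 == m - s.+1 - 1) = (c == s.+1))%N /\
   ((m - c.+1 == (m - s.+1 - 1).+1) = (c == s))%N by lia.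
have [-> ->] := E _ am; have [-> ->] := E _ bm.
have -> : (m - a.+1 == m - b.+1)%N = (a == b :> nat) by lia.
rewrite -[Some _ == _]/(nat_of_ord a == s) (eq_sym s.+1) (eq_sym s).
have [as1|as1] := eqVneq (a : nat) s.+1.
  have [->|_] := eqVneq (b : nat) s.+1.
    by rewrite mulmx1 (gtn_eqF (ltnSn s)) addr0.
  by rewrite mulmx0 add0r.
case: (nat_of_ord a == s) => //.
by have [->|_] := eqVneq (b : nat) s; rewrite ?(ltn_eqF (ltnSn s)) //; case: ifP.
Qed.

Lemma elemmx_neg s P : (s < m)%N ->
  elemmx m (s%:Z - m%:Z) P = emx (smove (fun s => m.-1 - s)%N P s).
Proof.
move=> sm; have -> : s%:Z - m%:Z = Negz (m - s).-1 by lia.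
apply: bmx_matrixP => a b i j; rewrite bmxE.
have am := ltn_ord a; have bm := ltn_ord b.
rewrite /elemmx (_ : (m - s).-1.+1 == m = (s == 0%N))%N; last by lia.
case: s sm => [|s] sm /=; rewrite blocksE; congr ((_ : 'M_n) i j);
  rewrite -?val_eqE /lact /bid /=.
  have -> : (m - a.+1 == m - b.+1)%N = (a == b :> nat) by lia.
  have -> : (m - a.+1 == 0)%N = (a == m.-1 - 0 :> nat)%N by lia.
  rewrite addr0; case: (eqVneq (a : nat) (m.-1 - 0)%N) => [->|//].
  by case: eqP; rewrite ?mulmx1 ?mulmx0.
have E c : (c < m)%N ->
   ((m - c.+1 == m - (m - s.+1).-1.+1 - 1) = (c == m.-1 - s))%N /\
   ((m - c.+1 == (m - (m - s.+1).-1.+1 - 1).+1) = (c == m.-1 - s.+1))%N by lia.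
have [-> ->] := E _ am; have [-> ->] := E _ bm.
have -> : (m - a.+1 == m - b.+1)%N = (a == b :> nat) by lia.
rewrite -[Some _ == _]/(nat_of_ord a == m.-1 - s)%N !(eq_sym _ (nat_of_ord b)).
have ne : ((m.-1 - s.+1 == m.-1 - s) = false)%N by lia.
have [->|as1] := eqVneq (a : nat) (m.-1 - s.+1)%N; rewrite ?ne.
  have [->|_] := eqVneq (b : nat) (m.-1 - s.+1)%N.
    by rewrite mulmx1 ne addr0.
  by rewrite mulmx0 add0r.
case: (nat_of_ord a == m.-1 - s)%N => //.
by have [->|_] := eqVneq (b : nat) (m.-1 - s)%N; rewrite ?ne 1?eq_sym ?ne //; case: ifP.
Qed.

End BlockMatrices.

(** * Congruences and signs *)

Section Congruence.
Variables (S : comUnitRingType) (m n : nat).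
Implicit Types (f g : nat -> nat -> 'M[S]_n) (u v : nat) (p q : nat -> bool).
Implicit Types (x : move S n) (xs : seq (move S n)).

(** Associativity of matrix multiplication, for the row and column operations. *)
Lemma lact_ract x y f i j : lact x (ract y f) i j = ract y (lact x f) i j.
Proof.
case: x y => [u ou P] [v ov Q]; rewrite /lact /ract /=.
case: (j == v); case: (i == u); last 1 first.
- by case: (Some i == ou); case: (Some j == ov).
- case: ou => [a|]; case: ov => [b|];
  by rewrite ?addr0 ?mulmxDl ?mulmxDr ?mulmxA // addrACA.
- by case: (Some i == ou).
- by case: (Some j == ov).
Qed.

Definition mcong x f := ract x (lact x f).
Definition mcongs xs f := foldl (fun f x => mcong x f) f xs.

(** Signs are coded by booleans, with true for plus. A factor is applicable when
    its row label is minus and its column label is plus; [sign_step] exchanges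
    the two signs. *)
Definition sign_ok p x := ~~ p (mrow x) && (if mcol x is Some v then p v else true).
Definition sign_step p x i :=
  if i == mrow x then true else if Some i == mcol x then false else p i.

Definition sgb (b : bool) (M : 'M[S]_n) := if b then - M else M.

(** A congruence is a row operation followed by a column operation. Giving the rows
    and the columns separate signs, and letting f and g differ, allows each of
    the two operations to be treated by the same lemma [twisted_act]. *)
Definition twisted p q f g := forall i j, g j i = sgb (p i == q j) (f i j)^T.
Definition skewf p f := twisted p p f f.

Lemma twisted_sym p q f g : twisted p q f g -> twisted q p g f.
Proof.
by move=> h i j; rewrite h (eq_sym (q i)) /sgb; case: eqP; rewrite ?linearN /= trmxK ?opprK.
Qed.

(** If P is skew-symmetric then the row u of f is sent to P times it plus the row
    v. The first term changes its parity under transposition, which fits the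
    change of the sign at u from minus to plus, and the second one already has
    the parity that belongs to the plus label v. The row v becomes the old row u
    and takes over its sign. *)
Lemma twisted_act x p q f g : (mblk x)^T = - mblk x -> sign_ok p x ->
  twisted p q f g -> twisted (sign_step p x) q (lact x f) (ract x g).
Proof.
case: x => u ov P /= hP /andP[/= /negbTE pu pv] h i j.
rewrite /sign_step /ract /lact /=.
case: (i == u); last by case: (Some i == ov); rewrite h ?pu.
rewrite linearD /= trmx_mul hP mulmxN h pu.
case: ov pv => [v pv|_]; rewrite /sgb ?h ?pv ?linear0 ?addr0;
  by case: (q j) => /=; rewrite ?mulNmx ?opprD ?opprK.
Qed.

Lemma skewf_mcong x p f : (mblk x)^T = - mblk x -> sign_ok p x ->
  skewf p f -> skewf (sign_step p x) (mcong x f).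
Proof.
move=> hP hx /(twisted_act hP hx)/twisted_sym/(twisted_act hP hx) h i j.
by rewrite /mcong h lact_ract.
Qed.

Fixpoint valid p xs :=
  if xs is x :: xs' then
    [&& wf m x, (mblk x)^T == - mblk x, sign_ok p x & valid (sign_step p x) xs']
  else true.

Definition sign_steps p xs := foldl sign_step p xs.

Lemma skewf_mcongs xs p f : valid p xs -> skewf p f -> skewf (sign_steps p xs) (mcongs xs f).
Proof.
elim: xs p f => //= x xs IH p f /and4P[_ /eqP hP hx hxs] h.
exact/IH/skewf_mcong.
Qed.

Lemma valid_cat p xs ys : valid p (xs ++ ys) = valid p xs && valid (sign_steps p xs) ys.
Proof. by elim: xs p => //= x xs IH p; rewrite IH !andbA. Qed.

Definition emxs xs : 'M[S]_(m * n) := \big[mulmx/1%:M]_(x <- xs) emx m x.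

Lemma bmx_mcong x f : wf m x -> bmx m (mcong x f) = emx m x *m bmx m f *m emx m x.
Proof. by move=> wx; rewrite emx_lact // emx_ract. Qed.

Lemma bmx_mcongs p xs f : valid p xs ->
  bmx m (mcongs xs f) = emxs (rev xs) *m bmx m f *m emxs xs.
Proof.
elim: xs p f => [|x xs IH] p f; first by rewrite /emxs big_nil mulmx1 mul1mx.
case/and4P=> wx _ _ hxs; rewrite [mcongs _ _]/= (IH _ _ hxs) bmx_mcong // rev_cons -cats1.
by rewrite /emxs big_cat big_seq1 big_cons !mulmxA.
Qed.

Definition regular_move x := if mcol x is None then mblk x \in unitmx else true.

Lemma emxs_unit xs : all (@wf S m n) xs -> all regular_move xs -> emxs xs \in unitmx.
Proof.
elim: xs => [|x xs IH]; first by rewrite /emxs big_nil unitmx1.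
case/andP=> wx hxs /= /andP[rx /(IH hxs) h].
rewrite /emxs big_cons unitmx_mul h andbT; apply: emx_unit => // hx.
by move: rx; rewrite /regular_move hx.
Qed.

Lemma valid_wf p xs : valid p xs -> all (@wf S m n) xs.
Proof. by elim: xs p => //= x xs IH p /and4P[-> _ _ /IH]. Qed.

(** The label to which a factor sends the unit column at g: in the column v of
    [[P, I], [I, 0]] the only nonzero block is I, in row u. *)
Definition track (g : nat) x := if mcol x == Some g then mrow x else g.

(** The tracked label stays plus, so it never is the row label of an applicable
    factor; there its unit column would not remain a unit column. *)
Lemma sign_step_track p (g : nat) x : sign_ok p x -> p g -> sign_step p x (track g x).
Proof.
case: x => u [v|] P /andP[/= pu _] pg; rewrite /track /sign_step /=; last by case: eqP.
have E k : (Some k == Some g) = (k == g) by [].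
have E' k : (Some g == Some k) = (g == k) by [].
rewrite E; have [vg|vg] := eqVneq v g; first by rewrite eqxx.
by rewrite E' (eq_sym g v) (negbTE vg) pg; case: eqP.
Qed.

Lemma emx_track p (g : nat) x : wf m x -> sign_ok p x -> p g -> (g < m)%N ->
  [/\ (track g x < m)%N, emx m x *m ecol S m n g = ecol S m n (track g x) &
      (ecol S m n g)^T *m emx m x = (ecol S m n (track g x))^T].
Proof.
move=> wx /andP[pu _] pg gm.
have gu : (g == mrow x) = false by apply: contraNF pu => /eqP <-.
have lb a : lact x (@bid S n) g a = bid S n (track g x) a.
  by rewrite /lact /track gu eq_sym; case: eqP.
have rb a : ract x (@bid S n) a g = bid S n a (track g x).
  by rewrite /ract /track gu eq_sym; case: eqP.
split.
- case/andP: wx => um; rewrite /track; case: (mcol x) => [v /andP[vm _]|_] //.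
  by case: eqP.
- by apply: bmx_ecol => // a am; rewrite (lact_bid wx) rb.
- apply: trmx_inj; rewrite trmx_mul !trmxK /emx bmxT; apply: bmx_ecol => // a am.
  by rewrite lb /bid eq_sym; case: eqP => _; rewrite ?trmx1 ?trmx0.
Qed.

Lemma emxs_track p (g : nat) xs : valid p xs -> p g -> (g < m)%N ->
  let g' := foldl track g xs in
  [/\ (g' < m)%N, sign_steps p xs g', emxs (rev xs) *m ecol S m n g = ecol S m n g' &
      (ecol S m n g)^T *m emxs xs = (ecol S m n g')^T].
Proof.
elim: xs p g => [|x xs IH] p g.
  by rewrite /emxs big_nil /= mulmx1 mul1mx.
case/and4P=> wx _ okx hxs pg gm.
have [tm e1 e2] := emx_track wx okx pg gm.
have [h1 h2 h3 h4] := IH _ _ hxs (sign_step_track okx pg) tm.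
split=> //.
  rewrite rev_cons -cats1 /emxs big_cat big_seq1 -mulmxA e1.
  exact: h3.
by rewrite /emxs big_cons mulmxA e2; apply: h4.
Qed.

End Congruence.

(** * Nonzero blocks under congruence *)

Section Spine.
Variables (S : comUnitRingType) (m n : nat).
Implicit Types (f g : nat -> nat -> 'M[S]_n) (p q : nat -> bool).
Implicit Types (x : move S n) (xs : seq (move S n)) (s : nat -> nat).
Local Notation bid := (@bid S n).

(** What is known about the nonzero blocks of a matrix and survives congruences.
    The unit rows at the minus labels also determine, by skewness, the minus
    columns; the blocks that the factors fill in elsewhere are left unspecified. *)
Record spine p s f : Prop := Spine {
  spine_skew : skewf p f;
  spineK : involutive s;
  spine_lt : forall i, (i < m)%N -> (s i < m)%N;
  spine_plus : forall i, ~~ p i -> p (s i);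
  spine_row : forall i j, ~~ p i -> f i j = bid (s i) j;
  spine_neq0 : forall i, p i -> p (s i) -> s i != i -> f i (s i) != 0 }.

(** The pairing of a spine follows the exchange of rows made by a factor. *)
Definition swap x (i : nat) : nat :=
  if mcol x is Some v then if i == mrow x then v else if i == v then mrow x else i
  else i.

Lemma swapK x : involutive (swap x).
Proof.
case: x => u [v|] P i; rewrite /swap //=.
have [->|iu] := eqVneq i u; first by rewrite eqxx; case: eqP.
have [->|iv] := eqVneq i v; first by rewrite eqxx.
by rewrite (negbTE iu) (negbTE iv).
Qed.

Lemma swap_lt x i : wf m x -> (i < m)%N -> (swap x i < m)%N.
Proof.
case: x => u [v|] P; rewrite /wf /swap //= => /and3P[um vm _] im.
by case: (i == u); case: (i == v).
Qed.

Definition nonzero_move x := if mcol x is None then mblk x != 0 else true.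

Lemma ract_bid_row x k j : k != mrow x -> ract x bid k j = bid (swap x k) j.
Proof.
case: x => u [v|] P; rewrite /ract /swap /bid /= => /negbTE ku; rewrite ?ku ?mul0mx ?add0r.
  have -> : (Some j == Some v) = (j == v) by [].
  have [->|kv] := eqVneq k v; have [ju|ju] := eqVneq j u.
  - by [].
  - by rewrite (eq_sym v); case: (j == v).
  - by rewrite ju ?ku.
  - by have [->|//] := eqVneq j v; rewrite (negbTE kv).
by case: eqP => // ->; rewrite ku.
Qed.

Lemma eq_ract x f g i i' j : (forall k, f i k = g i' k) -> ract x f i j = ract x g i' j.
Proof. by move=> h; rewrite /ract !h; case: (mcol x) => [v|]; rewrite ?h. Qed.

Hypothesis n_gt0 : (0 < n)%N.

Lemma one_neq0 : (1%:M : 'M[S]_n) != 0.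
Proof.
case: n n_gt0 => // n' _; apply/eqP => /matrixP/(_ ord0 ord0)/eqP.
by rewrite !mxE eqxx oner_eq0.
Qed.

Lemma spine_col p s f i j : spine p s f -> ~~ p i -> p j -> f j i = bid (s i) j.
Proof.
move=> h pi pj; rewrite (spine_skew h i j) (negbTE pi) pj /= (spine_row h) //.
by rewrite /bid; case: eqP; rewrite ?trmx1 ?trmx0.
Qed.

(** The row u is minus, hence a unit row, and becomes the row v, which is minus
    afterwards. The block P enters only the row and the column of u, which is
    plus afterwards, and it is multiplied there by the unit row of the old label
    u; so it does not reach the blocks that pair plus labels, except for a factor
    without column label, where P itself becomes such a block and has to be
    nonzero. *)
Lemma spine_mcong x p s f : wf m x -> (mblk x)^T = - mblk x -> sign_ok p x ->
  nonzero_move x -> spine p s f ->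
  spine (sign_step p x) (swap x \o s \o swap x) (mcong x f).
Proof.
move=> wx hP okx nz h.
have pu : ~~ p (mrow x) by case/andP: okx.
have su_inj i : s i = s (mrow x) -> i = mrow x by move/(can_inj (spineK h)).
have sneu i : ~~ p i -> s i != mrow x.
  by move=> pi; apply: contraNneq pu => <-; exact: (spine_plus h).
split.
- exact: (skewf_mcong _ _ (spine_skew h)).
- by move=> i /=; rewrite swapK (spineK h) swapK.
- by move=> i im /=; apply: swap_lt => //; apply: (spine_lt h); apply: swap_lt.
- move=> i; rewrite /sign_step /swap /=.
  case: x {wx hP nz} okx pu su_inj sneu => u [v|] P /= okx pu su_inj sneu.
    have E k : (Some k == Some v) = (k == v) by [].
    case/andP: okx => _ /= pv.
    rewrite !E; have [//|iu] := eqVneq i u; have [iv _|iv pi] := eqVneq i v.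
      rewrite (negbTE (sneu _ pu)); have [_|sv] := eqVneq (s u) v; first by rewrite eqxx.
      by rewrite (negbTE (sneu _ pu)) (negbTE sv) (spine_plus h pu).
    rewrite (negbTE (sneu _ pi)); have [_|sv] := eqVneq (s i) v; first by rewrite eqxx.
    by rewrite (negbTE (sneu _ pi)) (negbTE sv) (spine_plus h pi).
  by case: eqP => // _ pi; rewrite (spine_plus h pi); case: eqP.
- move=> i j; rewrite /mcong /sign_step.
  have [//|iu] := eqVneq i (mrow x).
  have [iv _|iv pi] := eqVneq (Some i) (mcol x).
    transitivity (ract x bid (s (mrow x)) j).
      apply: eq_ract => k; rewrite /lact (negbTE iu) iv eqxx.
      exact: (spine_row h _ pu).
    rewrite ract_bid_row ?sneu //=; congr (bid (swap x (s _)) j).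
    by rewrite /swap -iv (negbTE iu) eqxx.
  have si : swap x i = i.
    rewrite /swap (negbTE iu); case E: (mcol x) iv => [v|] // iv.
    by rewrite ifN // -E.
  rewrite /= si -ract_bid_row ?sneu //.
  apply: eq_ract => k; rewrite /lact (negbTE iu) (negbTE iv).
  exact: (spine_row h _ pi).
- case E : (mcol x) => [v|]; last first.
    have sE i : swap x i = i by rewrite /swap E.
    move=> i; rewrite /sign_step E /= !sE => pi psi ne.
    have P0 : mblk x != 0 by move: nz; rewrite /nonzero_move E.
    rewrite /mcong /ract /lact E !addr0 /=.
    move: pi psi; have [->|iu] := eqVneq i (mrow x).
      rewrite (negbTE (sneu _ pu)) => _ _.
      by rewrite (spine_row h _ pu) /bid eqxx mulmx1.
    move=> pi.
    have [siu|siu psi] := eqVneq (s i) (mrow x); last exact: (spine_neq0 h).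
    by rewrite (spine_col h pu pi) /bid -siu (spineK h) eqxx mul1mx.
  move=> i.
  have flipE k : sign_step p x k = p (swap x k).
    rewrite /sign_step /swap E; have [_|ku] := eqVneq k (mrow x).
      by case/andP: okx => _; rewrite E => ->.
    rewrite -[Some _ == Some _]/(k == v :> nat).
    by case: eqP => // _; rewrite (negbTE pu).
  rewrite !flipE /= swapK => pa pb ne.
  move: (swap x i) (swapK x i) pa pb ne => a <- pa pb.
  rewrite (inj_eq (can_inj (@swapK x))) => ne.
  have au : a != mrow x by apply: contraTneq pa => ->.
  have bu : s a != mrow x by apply: contraTneq pb => ->.
  have lE j : lact x f (swap x a) j = f a j +
     (if a == v then mblk x *m bid (s (mrow x)) j else 0).
    rewrite /lact /swap E (negbTE au); have [->|av] := eqVneq a v.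
      by rewrite eqxx addrC (spine_row h _ pu).
    by rewrite (negbTE au) addr0 ifN //.
  have b0 c : a != c -> bid (s c) (s a) = 0.
    by move=> ac; rewrite /bid ifN // (inj_eq (can_inj (spineK h))) eq_sym.
  have -> : mcong x f (swap x a) (swap x (s a)) = f a (s a); last exact: (spine_neq0 h).
  have -> : swap x (s a) = if s a == v then mrow x else s a.
    by rewrite /swap E (negbTE bu).
  rewrite /mcong /ract E; have [bv|bv] := eqVneq (s a) v.
    rewrite eqxx !lE.
    have av : a != v by rewrite -bv eq_sym.
    rewrite (negbTE av) !addr0 bv (spine_col h pu pa) /bid ifN ?mul0mx ?add0r //.
    by apply: contraNneq bu => <-; rewrite (spineK h).
  rewrite (negbTE bu) ifN; last by rewrite -[Some _ == Some _]/(_ == v :> nat).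
  rewrite lE b0 1?eq_sym //; first by rewrite mulmx0 if_same addr0.
  by rewrite eq_sym.
Qed.

(** The two pairings together connect all the labels; stated through
    two-colourings, as needed for comparing signs. *)
Definition linked s1 s2 := forall d : nat -> bool,
  (forall i, (i < m)%N -> d (s1 i) = d i) ->
  (forall i, (i < m)%N -> d (s2 i) = d i) ->
  forall i j, (i < m)%N -> (j < m)%N -> d i = d j.

Lemma linked_mcong x s1 s2 : wf m x -> linked s1 s2 ->
  linked (swap x \o s1 \o swap x) (swap x \o s2 \o swap x).
Proof.
move=> wx h d h1 h2.
have hd i j : (i < m)%N -> (j < m)%N -> (d \o swap x) i = (d \o swap x) j.
  apply: h => k km /=.
    by have := h1 _ (swap_lt wx km); rewrite /= swapK.
  by have := h2 _ (swap_lt wx km); rewrite /= swapK.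
move=> i j im jm; have := hd _ _ (swap_lt wx im) (swap_lt wx jm).
by rewrite /= !swapK.
Qed.

Lemma spine_mcongs xs p s1 s2 f1 f2 : valid m p xs -> all nonzero_move xs ->
  spine p s1 f1 -> spine p s2 f2 -> linked s1 s2 ->
  exists t1 t2, [/\ spine (sign_steps p xs) t1 (mcongs xs f1),
    spine (sign_steps p xs) t2 (mcongs xs f2) & linked t1 t2].
Proof.
elim: xs p s1 s2 f1 f2 => [|x xs IH] p s1 s2 f1 f2; first by exists s1, s2.
case/and4P=> wx /eqP hP okx hxs /= /andP[nz nzs] h1 h2 hl.
by apply: (IH _ _ _ _ _ hxs nzs (spine_mcong wx hP okx nz h1)
  (spine_mcong wx hP okx nz h2)); apply: linked_mcong.
Qed.

Lemma spine_link p s f (d : nat -> bool) : spine p s f ->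
  (forall i j, (i < m)%N -> (j < m)%N -> f i j != 0 -> d i = d j) ->
  forall i, (i < m)%N -> d (s i) = d i.
Proof.
move=> h hd.
have minus i : (i < m)%N -> ~~ p i -> d (s i) = d i.
  move=> im pi; apply/esym/hd => //; first exact: (spine_lt h im).
  by rewrite (spine_row h _ pi) /bid eqxx one_neq0.
move=> i im; have [pi|/minus->//] := boolP (p i).
have [psi|psi] := boolP (p (s i)); last first.
  by rewrite -{2}(spineK h i) (minus (s i)) //; apply: (spine_lt h).
have [->//|ne] := eqVneq (s i) i.
by apply/esym/hd => //; [apply: (spine_lt h im) | apply: (spine_neq0 h)].
Qed.

(** This settles the uniqueness of signs: the labels at which two sign functions
    agree form such a colouring. *)
Lemma linked_const p q s1 s2 f1 f2 (d : nat -> bool) :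
  spine p s1 f1 -> spine q s2 f2 -> linked s1 s2 ->
  (forall i j, (i < m)%N -> (j < m)%N -> f1 i j != 0 -> d i = d j) ->
  (forall i j, (i < m)%N -> (j < m)%N -> f2 i j != 0 -> d i = d j) ->
  forall i j, (i < m)%N -> (j < m)%N -> d i = d j.
Proof.
by move=> h1 h2 hl d1 d2; apply: hl; [apply: (spine_link h1 d1) | apply: (spine_link h2 d2)].
Qed.

End Spine.

(** * The Hankel corner and the base pencil *)

(** Identities between blocks are checked label by label, discarding the cases
    that contradict the arithmetic of the labels. *)
Ltac split_ifs := repeat (case: ifP => ?; try (exfalso; lia)).
Ltac simpl_blocks := rewrite ?(mulmx1, mulmx0, mul1mx, mul0mx, addr0, add0r, oppr0) //.

Section Hankel.
Variables (S : comUnitRingType) (m n : nat) (c : nat -> 'M[S]_n).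
Hypothesis c_deg : forall i, (m < i)%N -> c i = 0.
Local Notation bid := (@bid S n).
Local Notation bmx := (@bmx S m n).

(** The factors with nonnegative index s, and those with index s - m. *)
Definition wmove s : move S n := smove id (- c s) s.
Definition zmove s : move S n := smove (fun s => m.-1 - s)%N (c (m - s)) s.

Definition hankel d (i j : nat) : 'M[S]_n :=
  if (d <= i)%N && (d <= j)%N then c (i + j + 1 - d) else bid i j.

(** Up to commutation an admissible tuple of index q consists of strings
    (a : a+1) followed by (0:q); these list the first and the second entries of
    the short strings. *)
Definition odds q k := [seq (q + i.*2.+1)%N | i <- rev (iota 0 k)].
Definition evens q k := [seq (q + i.*2.+2)%N | i <- rev (iota 0 k)].

Lemma oddsS q k : odds q k.+1 = (q + k.*2.+1)%N :: odds q k.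
Proof. exact: symcompl_rec. Qed.

Lemma evensS q k : evens q k.+1 = (q + k.*2.+2)%N :: evens q k.
Proof. by rewrite /evens -addn1 iotaD rev_cat. Qed.

Definition wmat s := emx m (wmove s).
Definition zmat s := emx m (zmove s).
Definition prodm N (X : nat -> 'M[S]_N) (s : seq nat) : 'M[S]_N :=
  \big[mulmx/1%:M]_(i <- s) X i.

Lemma prodm_cons N (X : nat -> 'M[S]_N) a s : prodm X (a :: s) = X a *m prodm X s.
Proof. exact: big_cons. Qed.

Lemma prodm_cat N (X : nat -> 'M[S]_N) s t :
  prodm X (s ++ t) = prodm X s *m prodm X t.
Proof. exact: big_cat. Qed.

Lemma emx_step (x : move S n) f g : wf m x ->
  (forall i j, (i < m)%N -> (j < m)%N -> lact x f i j = g i j) ->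
  emx m x *m bmx f = bmx g.
Proof. by move=> wx h; rewrite emx_lact //; apply: eq_bmx. Qed.

(** The stage between the Hankel blocks from d+1 on and from d on at which the
    factors of index at least t have been applied. The unit row at m-t is the one
    that the next factor overwrites. *)
Definition hankel_partial d t (i j : nat) : 'M[S]_n :=
  if (i < d)%N then bid i j
  else if (i < m - t)%N then hankel d i j
  else if i == (m - t)%N then bid d j else hankel d.+1 i j.

Lemma hankel_partial_step d t : (d + t < m)%N ->
  emx m (zmove t) *m bmx (hankel_partial d t.+1) = bmx (hankel_partial d t).
Proof.
move=> dt; apply: emx_step => [|i j im jm].
  by rewrite /wf /=; case: t dt => [|t] /=; lia.
case: t dt => [|t] dt; rewrite /lact /=.
  rewrite /hankel_partial /hankel /bid; split_ifs; simpl_blocks.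
  by congr (c _); lia.
  by apply/esym/c_deg; lia.
have -> : (Some i == Some (m.-1 - t)%N) = (i == m.-1 - t)%N by [].
rewrite /hankel_partial /hankel /bid; split_ifs; simpl_blocks.
all: by congr (c _); lia.
Qed.

Lemma hankel_partial_prod d t r : (d + t + r = m)%N -> 
  prodm zmat (iota t r) *m bmx (hankel d.+1) = bmx (hankel_partial d t).
Proof.
elim: r t => [|r IH] t dtr.
  rewrite /prodm big_nil mul1mx; apply: eq_bmx => i j im jm.
  by rewrite /hankel_partial /hankel /bid; split_ifs; simpl_blocks.
rewrite [iota _ _]/= prodm_cons -mulmxA IH; last by lia.
by apply: hankel_partial_step; lia.
Qed.

Lemma hankel_step q : (q < m)%N ->
  prodm zmat (iota 0 q.+1) *m bmx (hankel (m - q)) = bmx (hankel (m.-1 - q)).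
Proof.
move=> qm; have -> : (m - q = (m.-1 - q).+1)%N by lia.
rewrite hankel_partial_prod; last by lia.
apply: eq_bmx => i j im jm; rewrite /hankel_partial /hankel /bid; split_ifs; simpl_blocks.
Qed.

Lemma revc_rec q : revc q.+1 = iota 0 q.+1 ++ revc q.
Proof. by rewrite /revc -{1}[q.+1]addn1 iotaD rev_cat add1n. Qed.

(** By induction on q: (0:q)_rev_c starts with the string (0:q-1), and each string
    adds one label to the Hankel block. *)
Lemma revc_hankel q : (q <= m)%N -> prodm zmat (revc q) = bmx (hankel (m - q)).
Proof.
elim: q => [|q IH] qm.
  rewrite /prodm big_nil subn0 -bmx1; apply: eq_bmx => i j im jm.
  by rewrite /hankel ifN //; lia.
rewrite revc_rec prodm_cat IH ?hankel_step //; last by lia.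
by congr (bmx (hankel _)); lia.
Qed.

End Hankel.

Section BasePencil.
Variables (S : comUnitRingType) (m n : nat) (c : nat -> 'M[S]_n) (e : nat).
Hypotheses (lt_em : (e < m)%N) (e_even : ~~ odd e).
Local Notation bid := (@bid S n).
Local Notation bmx := (@bmx S m n).
Local Notation wmove := (@wmove S n c).
Local Notation zmove := (@zmove S m n c).
Local Notation wmat := (@wmat S m n c).
Local Notation zmat := (@zmat S m n c).
Local Notation hankel := (@hankel S n c).

(** The base pencil x U - V; c stands for the coefficients of the matrix
    polynomial. Up to e both matrices couple neighbouring labels, U in the pairs
    (0,1), (2,3), ... and V in the pairs (1,2), (3,4), ... *)
Definition Ublk (i j : nat) : 'M[S]_n :=
  if (e <= i)%N && (e <= j)%N then c (i + j + 1 - e)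
  else if i == j then (if odd i then 0 else c i.+1)
  else if (odd i && (i == j.+1)) || (odd j && (j == i.+1)) then 1%:M else 0.

Definition Vblk (i j : nat) : 'M[S]_n :=
  if (e < i)%N && (e < j)%N then c (i + j - e)
  else if i == j then (if odd i then 0 else - c i)
  else if (~~ odd i && (i == j.+1)) || (~~ odd j && (j == i.+1)) then 1%:M else 0.

(** Intermediate stages between U, V and their Hankel corners. One family of
    factors reaches them from the Hankel corner and the other one from the full
    matrix. *)
Definition Utrunc d (i j : nat) : 'M[S]_n :=
  if (i < d)%N || (j < d)%N then bid i j else Ublk i j.

Definition Vtrunc d (i j : nat) : 'M[S]_n :=
  if (d < i <= e)%N || (d < j <= e)%N then bid i j else Vblk i j.

Lemma Utrunc_step_w k : (k.+1.*2 <= e)%N ->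
  emx m (wmove k.*2.+1) *m bmx (Utrunc k.*2) = bmx (Utrunc k.+1.*2).
Proof.
move=> ke; apply: emx_step => [|i j im jm]; first by rewrite /wf /=; lia.
rewrite /lact /=.
have -> : (Some i == Some k.*2) = (i == k.*2) by [].
rewrite /Utrunc /Ublk /bid; split_ifs; simpl_blocks.
by rewrite addNr.
Qed.

Lemma Utrunc_step_z k s : (k.+1.*2 <= e)%N -> (k.*2 + s.+1 = m.-1)%N ->
  emx m (zmove s.+1) *m bmx (Utrunc k.+1.*2) = bmx (Utrunc k.*2).
Proof.
move=> ke ks; apply: emx_step => [|i j im jm]; first by rewrite /wf /=; lia.
rewrite /lact /=.
have -> : (Some i == Some (m.-1 - s)%N) = (i == m.-1 - s)%N by [].
have -> : (m.-1 - s.+1)%N = k.*2 by lia.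
have -> : (m.-1 - s)%N = k.*2.+1 by lia.
have -> : (m - s.+1)%N = k.*2.+1 by lia.
rewrite /Utrunc /Ublk /bid; split_ifs; simpl_blocks.
by congr (c _); lia.
Qed.

Lemma Vtrunc_0 : emx m (wmove 0) *m bmx (hankel e.+1) = bmx (Vtrunc 0).
Proof.
apply: emx_step => [|i j im jm]; first by rewrite /wf /=; lia.
rewrite /lact /=.
rewrite /Vtrunc /Vblk /hankel /bid; split_ifs; simpl_blocks.
  by congr (- c _); lia.
by congr (c _); lia.
Qed.

Lemma Vtrunc_step_w k : (k.+1.*2 <= e)%N ->
  emx m (wmove k.+1.*2) *m bmx (Vtrunc k.*2) = bmx (Vtrunc k.+1.*2).
Proof.
move=> ke; apply: emx_step => [|i j im jm]; first by rewrite /wf /=; lia.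
rewrite /lact /=.
have -> : (Some i == Some k.*2.+1) = (i == k.*2.+1) by [].
rewrite /Vtrunc /Vblk /bid; split_ifs; simpl_blocks.
by congr (- c _); lia.
Qed.

Lemma Vtrunc_step_z k s : (k.+1.*2 <= e)%N -> (k.*2.+1 + s.+1 = m.-1)%N ->
  emx m (zmove s.+1) *m bmx (Vtrunc k.+1.*2) = bmx (Vtrunc k.*2).
Proof.
move=> ke ks; apply: emx_step => [|i j im jm]; first by rewrite /wf /=; lia.
rewrite /lact /=.
have -> : (Some i == Some (m.-1 - s)%N) = (i == m.-1 - s)%N by [].
have -> : (m.-1 - s.+1)%N = k.*2.+1 by lia.
have -> : (m.-1 - s)%N = k.*2.+2 by lia.
have -> : (m - s.+1)%N = k.+1.*2 by lia.
rewrite /Vtrunc /Vblk /bid; split_ifs; simpl_blocks.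
by rewrite -[k.+1.*2]/(k.*2.+2) subrr.
Qed.

Lemma Utrunc_w k : (k.*2 <= e)%N ->
  prodm wmat (odds 0 k) *m bmx Ublk = bmx (Utrunc k.*2).
Proof.
elim: k => [|k IH] ke.
  by rewrite /prodm big_nil mul1mx; apply: eq_bmx => i j _ _; rewrite /Utrunc.
rewrite oddsS prodm_cons -mulmxA IH; last by lia.
exact: Utrunc_step_w.
Qed.

Lemma Utrunc_z k k' : ((k + k').*2 = e)%N ->
  prodm zmat (evens (m.-1 - e) k) *m bmx (hankel e) = bmx (Utrunc k'.*2).
Proof.
elim: k k' => [|k IH] k' ke.
  rewrite /prodm big_nil mul1mx; apply: eq_bmx => i j _ _.
  by rewrite /Utrunc /hankel /Ublk /bid; split_ifs; simpl_blocks.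
rewrite evensS prodm_cons -mulmxA (IH k'.+1); last by lia.
have -> : (m.-1 - e + k.*2.+2 = (m.-1 - e + k.*2.+1).+1)%N by lia.
by apply: Utrunc_step_z; lia.
Qed.

Lemma Vtrunc_w k : (k.*2 <= e)%N ->
  prodm wmat (evens 0 k) *m (wmat 0 *m bmx (hankel e.+1)) = bmx (Vtrunc k.*2).
Proof.
elim: k => [|k IH] ke; first by rewrite /prodm big_nil mul1mx; apply: Vtrunc_0.
rewrite evensS prodm_cons -mulmxA IH; last by lia.
exact: Vtrunc_step_w.
Qed.

Lemma Vtrunc_z k k' : ((k + k').*2 = e)%N ->
  prodm zmat (odds (m.-1 - e) k) *m bmx Vblk = bmx (Vtrunc k'.*2).
Proof.
elim: k k' => [|k IH] k' ke.
  rewrite /prodm big_nil mul1mx; apply: eq_bmx => i j _ _; rewrite /Vtrunc.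
  by rewrite ifN //; lia.
rewrite oddsS prodm_cons -mulmxA (IH k'.+1); last by lia.
have -> : (m.-1 - e + k.*2.+1 = (m.-1 - e + k.*2).+1)%N by lia.
by apply: Vtrunc_step_z; lia.
Qed.

End BasePencil.

(** * Products of commuting factors *)

Lemma mem_odds q k i : (i \in odds q k) = (q < i < q + k.*2)%N && odd (i - q).
Proof.
elim: k => [|k IH]; first by rewrite in_nil; lia.
rewrite oddsS in_cons IH; lia.
Qed.

Lemma mem_revc q i : i \in revc q -> (i < q)%N.
Proof.
elim: q => // q IH; rewrite revc_rec mem_cat mem_iota => /orP[|/IH]; lia.
Qed.

Section Commutation.
Variables (S : comUnitRingType) (N : nat).
Implicit Types (M : 'M[S]_N) (X Y : nat -> 'M[S]_N) (s t : seq nat).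

Lemma prodm_commr M X s :
  (forall i, i \in s -> M *m X i = X i *m M) -> M *m prodm X s = prodm X s *m M.
Proof.
elim: s => [|i s IH] h; first by rewrite /prodm big_nil mulmx1 mul1mx.
rewrite prodm_cons mulmxA h ?mem_head // -!mulmxA IH // => k ks.
by apply: h; rewrite in_cons ks orbT.
Qed.

Lemma prodm_comm X Y s t :
  (forall i j, i \in s -> j \in t -> X i *m Y j = Y j *m X i) ->
  prodm X s *m prodm Y t = prodm Y t *m prodm X s.
Proof.
move=> h; apply: prodm_commr => j jt; apply/esym; apply: prodm_commr => i si.
exact/esym/h.
Qed.

Lemma prodm_rev X s : (forall i j, i \in s -> j \in s -> X i *m X j = X j *m X i) ->
  prodm X (rev s) = prodm X s.
Proof.
elim: s => // i s IH h; rewrite rev_cons -cats1 prodm_cat prodm_cons.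
rewrite IH; last by move=> a b sa sb; apply: h; rewrite in_cons ?sa ?sb orbT.
rewrite prodm_cons {2}/prodm big_nil mulmx1; apply/esym/prodm_commr => k ks.
by apply: h; rewrite ?mem_head // in_cons ks orbT.
Qed.

Variable (p : nat) (X : nat -> 'M[S]_N).
Hypothesis X_comm : forall i j, (i <= p)%N -> (j <= p)%N ->
  (i.+1 < j)%N || (j.+1 < i)%N -> X i *m X j = X j *m X i.

Lemma prodm_commutes g g' : commutes_to g g' -> all (leq^~ p) g ->
  prodm X g = prodm X g'.
Proof.
elim=> // s t i j u hij _ IH hall.
have [ip jp] : (i <= p)%N /\ (j <= p)%N.
  by move: hall; rewrite all_cat /= => /and4P[].
rewrite -IH; last by move: hall; rewrite !all_cat /= !ip !jp.
by rewrite !prodm_cat !prodm_cons !mulmxA -(mulmxA _ (X i)) X_comm // !mulmxA.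
Qed.

(** The even-offset entry of a string of length two differs by more than 1 from the
    odd-offset entries of the lower strings, and can be moved behind them. *)
Lemma prodm_strs q k : (q + k.*2 <= p)%N ->
  prodm X (strs (adm_strings (q + k.*2) q)) =
  prodm X (odds q k) *m prodm X (evens q k) *m prodm X (iota 0 q.+1).
Proof.
rewrite /adm_strings addKn doubleK strs_cat prodm_cat.
have -> : strs [:: (0%N, q)] = iota 0 q.+1 by rewrite /strs /= cats0.
move=> qp; congr (_ *m _); elim: k qp => [|k IH] qp.
  by rewrite /prodm !big_nil mulmx1.
rewrite strs_pairs_rec oddsS evensS !prodm_cons IH; last by lia.
rewrite -!mulmxA; congr (_ *m _); rewrite !mulmxA; congr (_ *m _).
by apply: prodm_commr => i; rewrite mem_odds => hi; apply: X_comm; lia.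
Qed.

Lemma prodm_admissible q g : admissible p q g ->
  prodm X g = prodm X (odds q (p - q)./2) *m prodm X (evens q (p - q)./2)
                *m prodm X (iota 0 q.+1).
Proof.
move=> [hperm leqp pq_even [_ _ hcom]].
rewrite (prodm_commutes hcom); last first.
  by apply/allP => i; rewrite (perm_mem hperm) mem_iota; lia.
have E : (p = q + (p - q)./2.*2)%N.
  by have := odd_double_half (p - q); rewrite (negbTE pq_even); lia.
by rewrite {1}E prodm_strs //; lia.
Qed.

End Commutation.

(** * Reduction to the base pencil *)

Section MoveCommutation.
Variables (S : comUnitRingType) (m n : nat).
Implicit Types (x y : move S n).

Definition supp x := mrow x :: (if mcol x is Some v then [:: v] else [::]).

Lemma lact_comm x y f i j : ~~ has (mem (supp x)) (supp y) ->
  lact x (lact y f) i j = lact y (lact x f) i j.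
Proof.
case: x y => [u ou P] [v ov Q]; rewrite /supp /= => hd.
have uv : (u == v) = false by apply: contraNF hd => /eqP->; rewrite inE eqxx.
have ouv a : ou = Some a -> ((a == v) = false) * ((v == a) = false).
  move=> e; rewrite e in hd; rewrite (eq_sym v); have [av|//] := eqVneq a v.
  by move: hd; rewrite av !inE eqxx orbT.
have uov a : ov = Some a -> ((a == u) = false) * ((u == a) = false).
  move=> e; rewrite e in hd; rewrite (eq_sym u); have [av|//] := eqVneq a u.
  by move: hd; rewrite /= av !inE eqxx orbT.
have ouov a b : ou = Some a -> ov = Some b -> ((a == b) = false) * ((b == a) = false).
  move=> e e'; rewrite e e' in hd; rewrite (eq_sym b); have [av|//] := eqVneq a b.
  by move: hd; rewrite /= av !inE eqxx !orbT.
rewrite /lact /= (eq_sym v) uv.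
have E (k l : nat) : (Some k == Some l) = (k == l) by [].
have E' (k : nat) : (Some k == None) = false by [].
case: ou ov ouv uov ouov {hd} => [a|] [b|] ouv uov ouov; rewrite ?E ?E'.
- rewrite !(ouv _ erefl) !(uov _ erefl) !(ouov _ _ erefl erefl).
  by do 4?[have [->|] := eqVneq i _; rewrite ?uv ?(eq_sym v u) ?uv ?(ouv _ erefl) ?(uov _ erefl) ?(ouov _ _ erefl erefl) //= => ?].
- rewrite !(ouv _ erefl).
  by do 3?[have [->|] := eqVneq i _; rewrite ?uv ?(eq_sym v u) ?uv ?(ouv _ erefl) //= => ?].
- rewrite !(uov _ erefl).
  by do 3?[have [->|] := eqVneq i _; rewrite ?uv ?(eq_sym v u) ?uv ?(uov _ erefl) //= => ?].
by do 2?[have [->|] := eqVneq i _; rewrite ?uv ?(eq_sym v u) ?uv //= => ?].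
Qed.

Lemma emx_comm x y : wf m x -> wf m y -> ~~ has (mem (supp x)) (supp y) ->
  emx m x *m emx m y = emx m y *m emx m x.
Proof.
move=> wx wy hd; rewrite {2}/emx emx_lact // [in RHS]/emx emx_lact //.
by apply: eq_bmx => i j _ _; apply: lact_comm.
Qed.

Variable c : nat -> 'M[S]_n.
Local Notation w := (wmat m c).
Local Notation z := (zmat m c).

Lemma wf_wmove s : (s < m)%N -> wf m (wmove c s).
Proof. by rewrite /wf; case: s => [|s] /=; lia. Qed.

Lemma wf_zmove s : (s < m)%N -> wf m (zmove m c s).
Proof. by rewrite /wf; case: s => [|s] /=; lia. Qed.

Lemma ww_comm i j : (i < m)%N -> (j < m)%N -> (i.+1 < j)%N || (j.+1 < i)%N ->
  w i *m w j = w j *m w i.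
Proof.
move=> im jm hij; apply: emx_comm; rewrite ?wf_wmove //.
by case: i j im jm hij => [|i] [|j] im jm hij; rewrite /supp /= ?inE; lia.
Qed.

Lemma zz_comm i j : (i < m)%N -> (j < m)%N -> (i.+1 < j)%N || (j.+1 < i)%N ->
  z i *m z j = z j *m z i.
Proof.
move=> im jm hij; apply: emx_comm; rewrite ?wf_zmove //.
by case: i j im jm hij => [|i] [|j] im jm hij; rewrite /supp /= ?inE; lia.
Qed.

(** The labels of the factor w_i are at most i, those of z_j at least m-1-j. *)
Lemma wz_comm i j : (i + j + 1 < m)%N -> w i *m z j = z j *m w i.
Proof.
move=> ijm; apply: emx_comm; rewrite ?wf_wmove ?wf_zmove //; try lia.
by case: i j ijm => [|i] [|j] ijm; rewrite /supp /= ?inE; lia.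
Qed.

End MoveCommutation.

Section BaseProduct.
Variables (S : comUnitRingType) (m n : nat) (c : nat -> 'M[S]_n) (h j : nat).
Hypothesis c_deg : forall i, (m < i)%N -> c i = 0.
Let p := (m - h - 1)%N.
Hypotheses (hm : (h < m)%N) (h_even : ~~ odd h).
Variables (w z tw tz : seq nat).
Hypotheses (hw : admissible h 0 w) (hz : admissible p j z).
Hypotheses (htw : all (ltn^~ h) tw) (htz : all (ltn^~ p) tz).

Local Notation e := (m.-1 - j)%N.
Local Notation wmat := (wmat m c).
Local Notation zmat := (zmat m c).
Local Notation Ow := (prodm wmat (odds 0 h./2)).
Local Notation Oz := (prodm zmat (odds j (p - j)./2)).

Let jp : (j <= p)%N. Proof. by case: hz. Qed.
Let pjE : (p - j = (p - j)./2.*2)%N.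
Proof. by case: hz => _ _ ho _; have := odd_double_half (p - j); rewrite (negbTE ho); lia. Qed.
Let hE : (h = h./2.*2)%N.
Proof. by have := odd_double_half h; rewrite (negbTE h_even); lia. Qed.

Let comm_OwOz : Ow *m Oz = Oz *m Ow.
Proof.
by apply: prodm_comm => a b; rewrite !mem_odds => ha hb; apply: wz_comm; lia.
Qed.

Let comm_OwRz : Ow *m prodm zmat (revc j) = prodm zmat (revc j) *m Ow.
Proof.
apply: prodm_comm => a b; rewrite !mem_odds => ha /mem_revc hb.
by apply: wz_comm; lia.
Qed.

Let comm_OzRz : Oz *m prodm zmat (revc j) = prodm zmat (revc j) *m Oz.
Proof.
apply: prodm_comm => a b; rewrite !mem_odds => ha /mem_revc hb.
by apply: zz_comm; lia.
Qed.

Let e_even : ~~ odd e.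
Proof.
have -> : e = (h + (p - j)./2.*2)%N by rewrite -pjE; lia.
by rewrite oddD odd_double addbF.
Qed.

Let lt_em : (e < m)%N. Proof. lia. Qed.
Let ej : (m.-1 - e = j)%N. Proof. lia. Qed.

(** Once the odd-offset factors of z are taken out on the left, and those of both
    symmetric complements on the right, (0:Ind z) and rev_c give the Hankel
    corner, and the even-offset factors of z extend it to the stage that the
    factors of c_w reach from U. *)
Lemma prodm_base_U :
  prodm zmat z *m prodm wmat (symcompl h 0) *m prodm zmat (symcompl p j) =
  Oz *m Ow *m bmx m (Ublk c e) *m Ow *m Oz.
Proof.
rewrite (prodm_admissible _ hz); last by move=> *; apply: zz_comm; lia.
rewrite [symcompl h 0]cats0 subn0 -/(odds 0 _) prodm_cat -/(odds j _).
rewrite comm_OzRz -!mulmxA (mulmxA Ow) comm_OwRz -!mulmxA.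
congr (_ *m _); rewrite !mulmxA; congr (_ *m _ *m _).
rewrite -!mulmxA (revc_hankel c_deg) ?(hankel_step c_deg); try lia.
have := @Utrunc_z _ _ n c e lt_em e_even (p - j)./2 h./2; rewrite ej => ->; last by lia.
by rewrite (Utrunc_w c lt_em) // -?hE; lia.
Qed.

(** The odd factors of w are taken out on the left; its other factors, applied to
    the Hankel block of rev_c, give the stage that the odd-offset factors of z
    reach from V. *)
Lemma prodm_base_V :
  prodm wmat w *m prodm wmat (symcompl h 0) *m prodm zmat (symcompl p j) =
  Oz *m Ow *m bmx m (Vblk c e) *m Ow *m Oz.
Proof.
rewrite (prodm_admissible _ hw); last by move=> *; apply: ww_comm; lia.
rewrite [symcompl h 0]cats0 subn0 -/(odds 0 _) prodm_cat -/(odds j _).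
rewrite comm_OzRz -!mulmxA (mulmxA Ow (prodm zmat (revc j))) comm_OwRz -!mulmxA.
rewrite (mulmxA Oz) -comm_OwOz -!mulmxA.
congr (_ *m _); rewrite !mulmxA; congr (_ *m _ *m _).
rewrite -!mulmxA (revc_hankel c_deg); last by lia.
have -> : (m - j = e.+1)%N by lia.
rewrite [iota 0 1]/= prodm_cons {2}/prodm big_nil mulmx1.
rewrite (Vtrunc_w c lt_em e_even); last by rewrite -hE; lia.
have := @Vtrunc_z _ _ n c e lt_em e_even (p - j)./2 h./2; rewrite ej => ->; last by lia.
by [].
Qed.

(** The factors by which the base pencil is transformed, from the innermost one
    outwards. *)
Definition hops : seq (move S n) :=
  map (wmove c) (odds 0 h./2) ++ map (zmove m c) (odds j (p - j)./2)
    ++ map (wmove c) tw ++ map (zmove m c) tz.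

Lemma emxs_cat (xs ys : seq (move S n)) :
  emxs m (xs ++ ys) = emxs m xs *m emxs m ys.
Proof. exact: big_cat. Qed.

Lemma emxs_wmove s : emxs m (map (wmove c) s) = prodm wmat s.
Proof. exact: big_map. Qed.

Lemma emxs_zmove s : emxs m (map (zmove m c) s) = prodm zmat s.
Proof. exact: big_map. Qed.

Lemma prodm_hops M :
  prodm zmat (rev tz) *m prodm wmat (rev tw) *m (Oz *m Ow *m M *m Ow *m Oz)
    *m prodm wmat tw *m prodm zmat tz = emxs m (rev hops) *m M *m emxs m hops.
Proof.
rewrite /hops !rev_cat -!(map_rev (wmove c)) -!(map_rev (zmove m c)) !emxs_cat !(emxs_wmove, emxs_zmove).
rewrite (prodm_rev (s := odds 0 _)) ?(prodm_rev (s := odds j _)) ?mulmxA //.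
  by move=> a b; rewrite !mem_odds => ha hb; have [->//|ab] := eqVneq a b; apply: zz_comm; lia.
by move=> a b; rewrite !mem_odds => ha hb; have [->//|ab] := eqVneq a b; apply: ww_comm; lia.
Qed.

Lemma prodm_pencil (M N : 'M[S]_(m * n)) :
  prodm zmat (rev tz) *m prodm wmat (rev tw) *m M *m N *m prodm wmat tw
    *m prodm zmat (symcompl p j) *m prodm zmat tz =
  prodm zmat (rev tz) *m prodm wmat (rev tw) *m (M *m N *m prodm zmat (symcompl p j))
    *m prodm wmat tw *m prodm zmat tz.
Proof.
rewrite !mulmxA -(mulmxA _ (prodm wmat tw)).
rewrite (prodm_comm (s := tw) (t := symcompl p j)) ?mulmxA // => a b.
move=> /(allP htw) /= ha; rewrite mem_cat -/(odds j _) mem_odds => hb.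
by apply: wz_comm; case/orP: hb => [|/mem_revc] hb; lia.
Qed.

Lemma pencil_mcongs q M N :
  valid m q hops ->
  (M = prodm zmat z /\ N = Ublk c e) \/ (M = prodm wmat w /\ N = Vblk c e) ->
  prodm zmat (rev tz) *m prodm wmat (rev tw) *m M *m prodm wmat (symcompl h 0)
     *m prodm wmat tw *m prodm zmat (symcompl p j) *m prodm zmat tz =
  bmx m (mcongs hops N).
Proof.
move=> hv hMN; rewrite prodm_pencil (bmx_mcongs _ hv) -prodm_hops.
by case: hMN => -[-> ->]; rewrite ?prodm_base_U ?prodm_base_V.
Qed.

End BaseProduct.

(** * Signs along type-1 tuples, and the tracked label *)

Section SideValid.
Variables (S : comUnitRingType) (m n p : nat) (lab : nat -> nat) (P : nat -> 'M[S]_n).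
Hypothesis lab_inj : forall s t, (s <= p)%N -> (t <= p)%N -> lab s = lab t -> s = t.
Hypothesis lab_lt : forall s, (s <= p)%N -> (lab s < m)%N.
Hypothesis P_skew : forall s, (P s)^T = - P s.
Local Notation side_move s := (smove lab (P s) s).
Implicit Type pl : nat -> bool.

Let labE s t : (s <= p)%N -> (t <= p)%N -> (lab s == lab t) = (s == t).
Proof. by move=> sp tp; apply/eqP/eqP => [|->//]; apply: lab_inj. Qed.

Lemma wf_side_move s : (s <= p)%N -> wf m (side_move s).
Proof.
move=> sp; rewrite /wf /= lab_lt //=; case: s sp => // s sp.
by rewrite lab_lt ?labE //; lia.
Qed.

Lemma sign_step_label pl s t : (s <= p)%N -> (t <= p)%N ->
  sign_step pl (side_move s) (lab t) = (t == s) || (t.+1 != s) && pl (lab t).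
Proof.
move=> sp tp; rewrite /sign_step /= labE //; case: eqP => //= _.
case: s sp => [|s] sp //=; rewrite -[Some _ == Some _]/(lab t == lab s) labE ?(ltnW sp) //.
by rewrite eqSS; case: eqP.
Qed.

Lemma sign_step_outside pl s i : (forall t, (t <= s)%N -> i != lab t) -> sign_step pl (side_move s) i = pl i.
Proof.
move=> h; rewrite /sign_step /= (negbTE (h _ (leqnn s))).
case: s h => [|s] h //.
by rewrite -[Some _ == Some _]/(i == lab s) (negbTE (h _ (leqnSn s))).
Qed.

(** The factors at q+1, q+3, ... act on disjoint pairs of labels (q, q+1),
    (q+2, q+3), ... and exchange the signs within each pair. *)
Lemma valid_odds pl q k : (q + k.*2 <= p)%N ->
  (forall i, (i < k)%N -> pl (lab (q + i.*2)%N) && ~~ pl (lab (q + i.*2.+1)%N)) ->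
  let xs := [seq side_move s | s <- odds q k] in
  [/\ valid m pl xs,
      forall t, (t <= p)%N -> sign_steps pl xs (lab t) =
         if (q <= t < q + k.*2)%N then odd (t - q) else pl (lab t) &
      forall i, (forall t, (t < q + k.*2)%N -> i != lab t) -> sign_steps pl xs i = pl i].
Proof.
elim: k pl => [|k IH] pl qp hpl xs.
  split=> // t tp; rewrite ifN //; lia.
have sp : (q + k.*2.+1 <= p)%N by lia.
have tp0 : (q + k.*2 <= p)%N by lia.
rewrite {}/xs oddsS map_cons [valid _ _ _]/= /sign_steps [foldl _ _ _]/=.
have [|i ik|h1 h2 h3] := IH (sign_step pl (side_move (q + k.*2.+1))); first by lia.
  rewrite !sign_step_label; try lia.
  have := hpl i; case: (pl _); case: (pl _) => /(_ ltac:(lia)) //= _; lia.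
split.
- rewrite wf_side_move // P_skew eqxx h1 andbT /= /sign_ok /= addnS.
  by have /andP[h4 h5] := hpl k (ltnSn k); rewrite -addnS h5.
- move=> t tp; have := h2 t tp; rewrite /sign_steps => ->; rewrite sign_step_label //.
  case: (ltnP t q) => tq /=; first by rewrite (_ : t == _ = false) 1?(_ : t.+1 == _ = false) //; lia.
  case: (ltnP t (q + k.*2)) => tk; first by rewrite ifT //; lia.
  have [->|tn] := eqVneq t (q + k.*2.+1)%N; first by rewrite ifT ?addKn ?addnS /= ?odd_double //; lia.
  have [tE|tn'] /= := eqVneq t.+1 (q + k.*2.+1)%N.
    by rewrite ifT; [rewrite (_ : t - q = k.*2)%N ?odd_double|]; lia.
  by rewrite ifN //; lia.
- move=> i hi; rewrite -/(sign_steps _ _) h3; first by apply: sign_step_outside => t ht; apply: hi; lia.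
  by move=> t ht; apply: hi; lia.
Qed.

(** The invariant: the sign at s is plus iff s = p or s+1 precedes s in the
    current tuple. It makes the next factor applicable, and it is preserved by
    the step. *)
Lemma valid_right_index pl alpha t :
  right_index_tuple1 p alpha t -> perm_eq alpha (iota 0 p.+1) ->
  (forall s, (s <= p)%N -> pl (lab s) = (s == p) || inversion_at alpha s) ->
  let xs := [seq side_move s | s <- t] in
  [/\ valid m pl xs, all (ltn^~ p) t &
      forall i, (forall s, (s < p)%N -> i != lab s) -> sign_steps pl xs i = pl i].
Proof.
move=> ht; elim: ht pl => {alpha t} [//|alpha s beta t hs _ IH] pl hperm hpl.
have [sp hbeta ncut cutp cutb] := right_index1_inversion_at hperm hs.
have [|h1 h2 h3] := IH (sign_step pl (side_move s)) hbeta.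
  move=> k kp; rewrite sign_step_label ?(ltnW sp) // hpl // cutb.
  have [->|//] := eqVneq k p; rewrite /= andbT; lia.
split.
- rewrite /= wf_side_move ?(ltnW sp) // P_skew eqxx h1 andbT /= /sign_ok /= hpl ?(ltnW sp) //.
  rewrite (negbTE ncut) orbF (ltn_eqF sp) /=.
  case: s sp cutp {hs ncut cutb h1 h2 h3 IH} => // s sp /(_ isT) /= hc.
  by rewrite hpl ?hc ?orbT //; lia.
- by rewrite /= sp.
- move=> i hi; rewrite /= -/(sign_steps _ _) h3 //; apply: sign_step_outside => k ks; apply: hi; lia.
Qed.

End SideValid.

Section HopsValid.
Variables (S : comUnitRingType) (m n : nat) (c : nat -> 'M[S]_n) (h j : nat).
Hypothesis c_skew : forall s, (c s)^T = - c s.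
Let p := (m - h - 1)%N.
Hypotheses (hm : (h < m)%N) (h_even : ~~ odd h).
Variables (w z tw tz : seq nat).
Hypotheses (hw : admissible h 0 w) (hz : admissible p j z).
Hypotheses (htw : right_index_tuple1 h (rev w) tw).
Hypotheses (htz : right_index_tuple1 p (rev z) tz).

Definition base_signs (e i : nat) : bool := ~~ odd i || (e < i)%N.

(** The odd-offset factors bring the signs of the base pencil to the pattern of
    rev(w) at the labels up to h and of rev(z) at the reversed ones, where type-1
    tuples apply. The two ranges share only the label h, which the factors of
    t_w and t_z do not touch, since their indices are less than h and m-h-1. *)
Lemma hops_valid :
  [/\ valid m (base_signs (m.-1 - j)) (hops m c h j tw tz),
      all (ltn^~ h) tw & all (ltn^~ p) tz].
Proof.
have jp : (j <= p)%N by case: hz.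
have pjE : (p - j = (p - j)./2.*2)%N.
  by case: hz => _ _ ho _; have := odd_double_half (p - j); rewrite (negbTE ho); lia.
have hE : (h = h./2.*2)%N.
  by have := odd_double_half h; rewrite (negbTE h_even); lia.
have rev_perm q q' g : admissible q q' g -> perm_eq (rev g) (iota 0 q.+1).
  by case=> hg _ _ _; rewrite perm_rev.
have w_inj s t : (s <= h)%N -> (t <= h)%N -> id s = id t -> s = t by [].
have w_lt s : (s <= h)%N -> (id s < m)%N by move=> /=; lia.
have w_skew s : (- c s)^T = - - c s by rewrite linearN /= c_skew.
have z_inj s t : (s <= p)%N -> (t <= p)%N -> (m.-1 - s = m.-1 - t)%N -> s = t by lia.
have z_lt s : (s <= p)%N -> (m.-1 - s < m)%N by lia.
have z_skew s : (c (m - s))^T = - c (m - s) by [].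
rewrite /hops !valid_cat.
set p0 := base_signs _.
have [|i ik|v1 f1 g1] := valid_odds w_inj w_lt w_skew (pl := p0) (q := 0) (k := h./2).
- by lia.
- by rewrite /p0 /base_signs /=; lia.
rewrite -/(wmove c) in v1 f1 g1.
rewrite v1 /=; move: f1 g1; set p1 := sign_steps p0 _ => f1 g1.
have [|i ik|v2 f2 g2] := valid_odds z_inj z_lt z_skew (pl := p1) (q := j) (k := (p - j)./2).
- by lia.
- by rewrite !g1 /p0 /base_signs => [|t ht|t ht]; lia.
rewrite -/(zmove m c) in v2 f2 g2.
rewrite v2 /=; move: f2 g2; set p2 := sign_steps p1 _ => f2 g2.
have [s sh|v3 a3 g3] := valid_right_index w_inj w_lt w_skew (pl := p2) htw (rev_perm _ _ _ hw).
  rewrite g2 => [|t ht]; last by lia.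
  rewrite f1 //; have [->|sn] := eqVneq s h; first by rewrite ifN /p0 /base_signs; lia.
  by rewrite ifT ?(inversion_at_rev_admissible hw) ?subn0 //=; lia.
rewrite -/(wmove c) in v3 g3.
rewrite v3 /=; move: g3; set p3 := sign_steps p2 _ => g3.
have [s sh|v4 a4 g4] := valid_right_index z_inj z_lt z_skew (pl := p3) htz (rev_perm _ _ _ hz).
  rewrite g3 => [|t ht]; last by lia.
  rewrite f2 // -pjE subnKC //; have [->|sn] := eqVneq s p.
    by rewrite ltnn andbF g1 => [|t ht]; [rewrite /p0 /base_signs|]; lia.
  rewrite (inversion_at_rev_admissible hz) /=; last by lia.
  case: (ltnP s j) => sj /=; first by rewrite g1 => [|t ht]; [rewrite /p0 /base_signs|]; lia.
  by rewrite ifT; lia.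
by split.
Qed.

End HopsValid.

Section HopsTrack.
Variables (S : comUnitRingType) (m n : nat) (c : nat -> 'M[S]_n) (h j : nat).

(** The label k-1 moves to k under the factor of index k and stays put under any
    other; the shift by one matches the first value that [greedy] has not yet
    found. *)
Lemma track_wmove k s : (0 < k)%N ->
  track k.-1 (wmove c s) = (if s == k then k.+1 else k).-1.
Proof.
case: k => // k _; rewrite /track /wmove /smove /=.
case: s => [|s] //=; rewrite -[Some _ == Some _]/(s == k) eqSS.
by case: eqP => [->|].
Qed.

Lemma tracks_wmove k t : (0 < k)%N ->
  foldl (@track S n) k.-1 (map (wmove c) t) = (greedy k t).-1.
Proof.
elim: t k => //= s t IH k k0; rewrite track_wmove // greedy_cons IH //.
by case: eqP.
Qed.

(** The z-type factors act on labels greater than h only. *)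
Lemma tracks_zmove g t : (g <= h)%N -> all (ltn^~ (m - h - 1)%N) t ->
  foldl (@track S n) g (map (zmove m c) t) = g.
Proof.
move=> gh; elim: t => //= s t IH /andP[hs /IH ht].
rewrite (_ : track g _ = g) // /track /zmove /smove /=.
case: s hs => [|s] hs //=; rewrite ifN //.
by rewrite -[Some _ == Some _]/(_ == g :> nat); lia.
Qed.

Lemma greedy_leq k b t : (k <= b.+1)%N -> all (ltn^~ b) t -> (greedy k t <= b.+1)%N.
Proof.
elim: t k => //= s t IH k kb /andP[sb ht]; rewrite greedy_cons IH //.
by case: eqP; lia.
Qed.

Lemma hops_track tw tz : (h < m)%N -> ~~ odd h -> (j <= m - h - 1)%N ->
  all (ltn^~ h) tw -> all (ltn^~ (m - h - 1)%N) tz ->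
  foldl (@track S n) 0 (hops m c h j tw tz) = (greedy 1 (symcompl h 0 ++ tw)).-1.
Proof.
move=> hm he jp htw htz; rewrite /hops !foldl_cat.
have hodds : all (ltn^~ h) (odds 0 h./2).
  apply/allP => i; rewrite mem_odds; have := odd_double_half h.
  by rewrite (negbTE he) /=; lia.
have g1 : (greedy 1 (odds 0 h./2) <= h.+1)%N by apply: greedy_leq.
have g1' : (1 <= greedy 1 (odds 0 h./2))%N by apply: leq_greedy.
have zodds : all (ltn^~ (m - h - 1)%N) (odds j (m - h - 1 - j)./2).
  apply/allP => i; rewrite mem_odds /=.
  by have := odd_double_half (m - h - 1 - j); lia.
have gh : ((greedy 1 (odds 0 h./2)).-1 <= h)%N by lia.
rewrite (tracks_wmove (k := 1)) // (tracks_zmove gh zodds) tracks_wmove // tracks_zmove //.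
  by rewrite [symcompl h 0]cats0 subn0 greedy_cat.
by have := greedy_leq g1 htw; lia.
Qed.

End HopsTrack.

(** * Triangular block matrices *)

Section Ranked.
Variables (S : comUnitRingType) (m n : nat).
Implicit Types (f g : nat -> nat -> 'M[S]_n).

(** A path of nonzero blocks increases the rank at every step, so its length is
    bounded. *)
Lemma nilpotent_ranked f (r : nat -> nat) b :
  (forall i j, (i < m)%N -> (j < m)%N -> f i j != 0 -> (r i < r j < b)%N) ->
  (bmx m f : 'M_(m * n)) ^+ b.+1 = 0.
Proof.
move=> hf.
have [g [hg ->]] : exists g, (forall i j, (i < m)%N -> (j < m)%N -> g i j != 0 ->
    (r i + b.+1 <= r j < b)%N) /\ (bmx m f : 'M_(m * n)) ^+ b.+1 = bmx m g.
  elim: {1 3}b => [|k [g [hg e]]].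
    exists f; split; last by rewrite expr1.
    by move=> i j im jm /(hf _ _ im jm); lia.
  exists (fun i j => \sum_(l < m) f i l *m g l j); split; last first.
    by rewrite exprS e -bmxM.
  move=> i j im jm; apply: contraTT => hr; apply/negPn/eqP.
  apply: big1 => l _; have [->|/(hf _ _ im (ltn_ord l)) fl] := eqVneq (f i l) 0.
    by rewrite mul0mx.
  have [->|/(hg _ _ (ltn_ord l) jm) gl] := eqVneq (g l j) 0; first by rewrite mulmx0.
  by exfalso; lia.
apply: (etrans (y := bmx m (fun _ _ => 0))).
  apply: eq_bmx => i j im jm; apply/eqP; apply: contraT => /(hg _ _ im jm); lia.
by apply: bmx_matrixP => a c i j; rewrite bmxE !mxE.
Qed.

(** A block matrix that is triangular for some ordering of the labels and has
    invertible diagonal blocks is invertible: up to its diagonal it is 1 - t with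
    t nilpotent. Ranks with repetitions are allowed, which avoids constructing a
    permutation. *)
Lemma ranked_unit f (r : nat -> nat) :
  (forall i, (i < m)%N -> f i i \in unitmx) ->
  (forall i j, (i < m)%N -> (j < m)%N -> i != j -> f i j != 0 -> (r i < r j)%N) ->
  bmx m f \in unitmx.
Proof.
move=> hu hr.
pose b := (\max_(i < m) r i).+1.
have rb i : (i < m)%N -> (r i < b)%N.
  by move=> im; rewrite ltnS (leq_bigmax (Ordinal im)).
pose d i j : 'M[S]_n := if i == j then invmx (f i i) else 0.
pose t i j := if i == j then 0 else - (invmx (f i i) *m f i j).
have dE : bmx m d *m bmx m f = 1%:M - bmx m t.
  rewrite bmxM -bmx1 bmxB; apply: eq_bmx => i j im jm.
  rewrite (bigD1 (Ordinal im)) //= {1}/d eqxx big1 ?addr0 => [|l nl]; last first.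
    by rewrite /d ifN ?mul0mx //; move: nl; rewrite -val_eqE eq_sym.
  rewrite /bid /t; have [<-|_] := eqVneq i j; first by rewrite subr0 mulVmx ?hu.
  by rewrite opprK add0r.
have t0 : (bmx m t : 'M_(m * n)) ^+ b.+1 = 0.
  apply: (nilpotent_ranked (r := r)) => i j im jm.
  rewrite /t; have [_|ij] := eqVneq i j; first by rewrite eqxx.
  rewrite oppr_eq0 => h; rewrite rb // andbT hr //.
  by apply: contraNneq h => ->; rewrite mulmx0.
have := subrX1 (bmx m t : 'M_(m * n)) b.+1; rewrite t0 sub0r => /(congr1 -%R).
rewrite opprK -mulNr opprB => /esym h.
have : (1%:M - bmx m t) \in unitmx by case/mulmx1_unit: h.
by rewrite -dE unitmx_mul => /andP[].
Qed.

End Ranked.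

(** * Signs and connectivity of the base pencil *)

Section BaseSpine.
Variables (S : comUnitRingType) (m n : nat) (c : nat -> 'M[S]_n) (e : nat).
Hypothesis c_skew : forall i, (c i)^T = - c i.
Hypotheses (lt_em : (e < m)%N) (e_even : ~~ odd e).
Local Notation bid := (@bid S n).
Local Notation U := (Ublk c e).
Local Notation V := (Vblk c e).

Lemma skewf_U : skewf (base_signs e) U.
Proof.
move=> i j; rewrite /Ublk /base_signs /sgb; split_ifs; rewrite ?c_skew ?trmx1 ?trmx0 ?opprK ?oppr0 //.
all: congr (c _); lia.
Qed.

Lemma skewf_V : skewf (base_signs e) V.
Proof.
move=> i j; rewrite /Vblk /base_signs /sgb; split_ifs;
  rewrite ?linearN /= ?c_skew ?trmx1 ?trmx0 ?opprK ?oppr0 //.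
  by congr (c _); lia.
by congr (- c _); lia.
Qed.

(** The block A_m lies on the antidiagonal of the Hankel corner, hence the
    reflections; the other partners are the labels coupled by I. In V the label
    0 is left over, and paired with itself. *)
Definition partnerU i := if (i < e)%N then (if odd i then i.-1 else i.+1)
  else if (i < m)%N then (m.-1 + e - i)%N else i.

Definition partnerV i := if (i <= e)%N then
    (if i == 0%N then 0%N else if odd i then i.+1 else i.-1)
  else if (i < m)%N then (m + e - i)%N else i.

Lemma spine_U : c m != 0 -> spine m (base_signs e) partnerU U.
Proof.
move=> cm; split.
- exact: skewf_U.
- by move=> i; rewrite {2}/partnerU; split_ifs; rewrite /partnerU; split_ifs; lia.
- by move=> i im; rewrite /partnerU; split_ifs; lia.
- by move=> i; rewrite /partnerU /base_signs => pi; split_ifs; lia.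
- move=> i j; rewrite /base_signs => pi.
  have -> : partnerU i = i.-1 by rewrite /partnerU; split_ifs; lia.
  by rewrite /Ublk /bid; split_ifs.
- move=> i; rewrite /base_signs /partnerU; split_ifs => pi psi si; try (exfalso; lia).
  rewrite /Ublk ifT; last by lia.
  by rewrite (_ : _ - e = m)%N //; lia.
Qed.

Lemma spine_V : c m != 0 -> spine m (base_signs e) partnerV V.
Proof.
move=> cm; split.
- exact: skewf_V.
- move=> i; rewrite {2}/partnerV; split_ifs; rewrite /partnerV; split_ifs; try lia.
  by rewrite leq0n eqxx; lia.
- by move=> i im; rewrite /partnerV; split_ifs; lia.
- by move=> i; rewrite /partnerV /base_signs => pi; split_ifs; lia.
- move=> i j; rewrite /base_signs => pi.
  have -> : partnerV i = i.+1 by rewrite /partnerV; split_ifs; lia.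
  by rewrite /Vblk /bid; split_ifs.
- move=> i; rewrite /base_signs /partnerV; split_ifs => pi psi si; try (exfalso; lia).
  rewrite /Vblk ifT; last by lia.
  by rewrite (_ : _ - e = m)%N //; lia.
Qed.

(** Below e the two pairings couple alternating neighbours, and above e they are
    two reflections whose centres differ by 1/2, whose product is a shift by 1. *)
Lemma linked_UV : linked m partnerU partnerV.
Proof.
move=> d hU hV.
have step i : (i.+1 < m)%N -> d i.+1 = d i.
  move=> im; case: (ltnP e i.+1) => ei.
    rewrite -(hV i.+1 im) /partnerV.
    have -> : (i.+1 <= e)%N = false by lia.
    rewrite im -(hU (m + e - i.+1)%N); last by lia.
    by rewrite /partnerU; split_ifs; congr d; lia.
  case: (boolP (odd i)) => oi.
    by rewrite -(hV i.+1 im) /partnerV ei /= oi.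
  by rewrite -(hU i.+1 im) /partnerU ifT ?oi //= ?oi //; lia.
have d0 i : (i < m)%N -> d i = d 0%N.
  by elim: i => // i IH im; rewrite step // IH //; lia.
by move=> i j im jm; rewrite !d0.
Qed.

End BaseSpine.

(** * A column that isolates the matrix polynomial *)

Lemma sum_pick (V : nmodType) m a (f : nat -> V) : (a < m)%N ->
  (forall j, (j < m)%N -> j != a -> f j = 0) -> \sum_(j < m) f j = f a.
Proof.
move=> am h; rewrite (bigD1 (Ordinal am)) //= big1 ?addr0 // => j.
by rewrite -val_eqE => /= ja; apply: h.
Qed.

Lemma sum_pick2 (V : nmodType) m a b (f : nat -> V) : (a < m)%N -> (b < m)%N -> a != b ->
  (forall j, (j < m)%N -> j != a -> j != b -> f j = 0) ->
  \sum_(j < m) f j = f a + f b.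
Proof.
move=> am bm ab h; rewrite (bigD1 (Ordinal am)) //= (bigD1 (Ordinal bm)) /=; last first.
  by rewrite -val_eqE eq_sym.
rewrite big1 ?addr0 // => j /andP[]; rewrite -!val_eqE /= => ja jb; exact: h.
Qed.

Section BaseLinearization.
Variables (S : comUnitRingType) (m n : nat) (c : nat -> 'M[S]_n) (e : nat) (x : S).
Hypothesis c_deg : forall i, (m < i)%N -> c i = 0.
Hypotheses (lt_em : (e < m)%N) (e_even : ~~ odd e).
Local Notation bid := (@bid S n).
Local Notation U := (Ublk c e).
Local Notation V := (Vblk c e).

(** The Horner tail c_i + x c_(i+1) + x^2 c_(i+2) + ... The bound m on the
    exponent only has to be large enough, as c vanishes beyond m; this makes the
    recursion [horner_shiftS] hold for every i. *)
Definition horner_shift i : 'M[S]_n := \sum_(l < m.+1) x ^+ l *: c (i + l).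

Lemma horner_shiftS i : horner_shift i = c i + x *: horner_shift i.+1.
Proof.
rewrite /horner_shift big_ord_recl /= expr0 scale1r addn0 scaler_sumr; congr (_ + _).
rewrite [RHS]big_ord_recr /= c_deg ?scaler0 ?addr0; last by lia.
by apply: eq_bigr => l _; rewrite scalerA exprS -[bump 0 l]/l.+1 addSnnS.
Qed.

(** Solves (x U - V) C = A e_0 from label 0 upwards. The odd rows below e force
    x^k at the label 2k, the even ones then determine the odd entries, and in the
    Hankel corner, where row e sums to a Horner tail, powers of x continue. *)
Definition factor_col (i : nat) : 'M[S]_n :=
  if (e < i)%N then (x ^+ (i - e + e./2))%:M
  else if odd i then x ^+ i./2.+1 *: horner_shift i.+1 else (x ^+ i./2)%:M.

Lemma sum_hankel i a b : (a <= m)%N -> (m < i + (m - a))%N ->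
  \sum_(j < m) (if (a <= j)%N then c (i + (j - a)) *m (x ^+ (j - a + b))%:M else 0) =
  x ^+ b *: horner_shift i.
Proof.
move=> am hi; rewrite -(big_mkord xpredT (fun j =>
  if (a <= j)%N then c (i + (j - a)) *m (x ^+ (j - a + b))%:M else 0)).
rewrite (big_cat_nat (leq0n a) am) /= big_nat big1 ?add0r => [|j hj]; last by rewrite ifN //; lia.
rewrite -{1}[a]add0n big_addn /horner_shift scaler_sumr.
rewrite -(big_mkord xpredT (fun l => x ^+ b *: (x ^+ l *: c (i + l)))).
have am' : (m - a <= m.+1)%N by lia.
rewrite [RHS](big_cat_nat (leq0n _) am') /=.
rewrite [X in _ + X]big_nat [X in _ + X]big1 ?addr0 => [|j hj]; last first.
  by rewrite c_deg ?scaler0 //; lia.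
apply: eq_bigr => l _; rewrite ifT; last by lia.
by rewrite addnK mul_mx_scalar scalerA -exprD addnC.
Qed.

Lemma sumU_odd i : odd i -> (i < e)%N ->
  \sum_(j < m) U i j *m factor_col j = (x ^+ i./2)%:M.
Proof.
move=> oi ie; rewrite (sum_pick (a := i.-1) (f := fun j => U i j *m factor_col j)) => [||j jm ji].
- rewrite /Ublk /factor_col; split_ifs; rewrite mul1mx; congr (x ^+ _)%:M; lia.
- lia.
- by rewrite /Ublk; split_ifs; rewrite mul0mx.
Qed.

Lemma sumV_odd i : odd i -> (i < e)%N ->
  \sum_(j < m) V i j *m factor_col j = (x ^+ i./2.+1)%:M.
Proof.
move=> oi ie; rewrite (sum_pick (a := i.+1) (f := fun j => V i j *m factor_col j)) => [||j jm ji].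
- rewrite /Vblk /factor_col; split_ifs; rewrite mul1mx; congr (x ^+ _)%:M; lia.
- lia.
- by rewrite /Vblk; split_ifs; rewrite mul0mx.
Qed.

Lemma sumU_even i : ~~ odd i -> (i <= e)%N ->
  \sum_(j < m) U i j *m factor_col j = x ^+ i./2 *: horner_shift i.+1.
Proof.
move=> oi; rewrite leq_eqVlt => /orP[/eqP ->|ie].
  rewrite -(@sum_hankel e.+1 e e./2); try lia.
  apply: eq_bigr => j _; rewrite /Ublk /factor_col; split_ifs; rewrite ?mul0mx //.
    by congr (c _ *m _); lia.
  by congr (c _ *m (x ^+ _)%:M); lia.
rewrite (sum_pick2 (a := i) (b := i.+1) (f := fun j => U i j *m factor_col j)); try lia.
  rewrite /Ublk /factor_col; split_ifs; rewrite mul1mx mul_mx_scalar (horner_shiftS i.+1) scalerDr scalerA.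
  by rewrite -exprSr; congr (_ + x ^+ _ *: _); lia.
by move=> j jm ji1 ji2; rewrite /Ublk; split_ifs; rewrite mul0mx.
Qed.

Lemma sumV_even i : ~~ odd i -> (0 < i <= e)%N ->
  \sum_(j < m) V i j *m factor_col j = x ^+ i./2 *: (x *: horner_shift i.+1).
Proof.
move=> oi ie.
rewrite (sum_pick2 (a := i) (b := i.-1) (f := fun j => V i j *m factor_col j)); try lia.
  rewrite /Vblk /factor_col; split_ifs; rewrite mul1mx mul_mx_scalar.
  rewrite prednK; last by lia.
  rewrite (horner_shiftS i) scalerDr scalerN (_ : i.-1./2.+1 = i./2)%N ?addrA ?addNr ?add0r //.
  lia.
by move=> j jm ji1 ji2; rewrite /Vblk; split_ifs; rewrite mul0mx.
Qed.

Lemma sumV_0 : \sum_(j < m) V 0 j *m factor_col j = - c 0.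
Proof.
rewrite (sum_pick (a := 0%N) (f := fun j => V 0 j *m factor_col j)) => [||j jm ji].
- by rewrite /Vblk /factor_col; split_ifs; rewrite mulmx1.
- lia.
- by rewrite /Vblk; split_ifs; rewrite mul0mx.
Qed.

Lemma sumU_top i : (e < i < m)%N ->
  \sum_(j < m) U i j *m factor_col j = x ^+ e./2 *: horner_shift i.+1.
Proof.
move=> ie; rewrite -(@sum_hankel i.+1 e e./2); try lia.
apply: eq_bigr => j _; rewrite /Ublk /factor_col; split_ifs; rewrite ?mul0mx //.
  by congr (c _ *m _); lia.
by congr (c _ *m (x ^+ _)%:M); lia.
Qed.

Lemma sumV_top i : (e < i < m)%N ->
  \sum_(j < m) V i j *m factor_col j = x ^+ e./2.+1 *: horner_shift i.+1.
Proof.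
move=> ie; rewrite -(@sum_hankel i.+1 e.+1 e./2.+1); try lia.
apply: eq_bigr => j _; rewrite /Vblk /factor_col; split_ifs; rewrite ?mul0mx //.
by congr (c _ *m (x ^+ _)%:M); lia.
Qed.

Lemma pencil_factor_col i : (i < m)%N ->
  \sum_(j < m) (x *: U i j - V i j) *m factor_col j = if i == 0%N then horner_shift 0 else 0.
Proof.
move=> im.
have -> : \sum_(j < m) (x *: U i j - V i j) *m factor_col j =
  x *: (\sum_(j < m) U i j *m factor_col j) - \sum_(j < m) V i j *m factor_col j.
  rewrite scaler_sumr -sumrB; apply: eq_bigr => j _.
  by rewrite mulmxBl scalemxAl.
case: (ltnP e i) => ei.
  rewrite sumU_top ?sumV_top ?ei // scalerA -exprS subrr.
  by case: eqP ei => // ->.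
have [oi|oi] := boolP (odd i).
  have ie : (i < e)%N by lia.
  rewrite sumU_odd // sumV_odd // scale_scalar_mx -exprS subrr.
  by case: eqP oi => // ->.
rewrite sumU_even //; have [->|i0] := eqVneq i 0%N.
  by rewrite sumV_0 opprK expr0 scale1r addrC -horner_shiftS.
rewrite sumV_even ?ei ?lt0n ?i0 // !scalerA mulrC subrr.
by [].
Qed.

End BaseLinearization.

(** * Equivalence of the base pencil with the matrix polynomial *)

Section ClearedCorner.
Variables (S : comUnitRingType) (m n : nat).
Implicit Types (K N : nat -> nat -> 'M[S]_n) (C : nat -> 'M[S]_n).
Local Notation bid := (@bid S n).

Definition cleared K (i j : nat) : 'M[S]_n :=
  if (i == 0%N) || (j == 0%N) then bid i j else K i j.

Definition corner (M : 'M[S]_n) (i j : nat) : 'M[S]_n :=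
  if (i == 0%N) && (j == 0%N) then M else bid i j.

(** The column C gives the column at label 0 of the congruence that splits off M,
    and its transpose gives the row at label 0 because K is skew-symmetric. The
    rest of K is then divided out. Both transformations fix the block unit
    vector at label 0, so that border blocks placed there survive. *)
Lemma clear_congruence K C M : (0 < m)%N ->
  (forall i j, K j i = - (K i j)^T) -> C 0%N = 1%:M ->
  (forall i, (i < m)%N -> \sum_(j < m) K i j *m C j = if i == 0%N then M else 0) ->
  bmx m (cleared K) \in unitmx ->
  exists Ub Vb : 'M[S]_(m * n),
    [/\ Ub \in unitmx, Vb \in unitmx, Ub *m bmx m K *m Vb = bmx m (corner M),
        Ub *m ecol S m n 0 = ecol S m n 0 &
        (ecol S m n 0)^T *m Vb = (ecol S m n 0)^T].
Proof.
move=> m0 Kskew C0 KC uN.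
pose u i j : 'M[S]_n := if i == 0%N then (C j)^T else bid i j.
have uU : bmx m u \in unitmx.
  apply: (ranked_unit (r := fun i => (i != 0)%N)) => [i im|i j im jm ij].
    by rewrite /u /bid eqxx; case: eqP => [->|_]; rewrite ?C0 ?trmx1 unitmx1.
  rewrite /u /bid (negbTE ij); have [i0 _|_] := eqVneq i 0%N; last by rewrite eqxx.
  by move: ij; rewrite i0 eq_sym => ->.
have Ue : bmx m u *m ecol S m n 0 = ecol S m n 0.
  apply: bmx_ecol => // a am; rewrite /u /bid.
  by case: eqP => // _; rewrite C0 trmx1.
have KU : bmx m K *m (bmx m u)^T =
    bmx m (fun i j => if j == 0%N then (if i == 0%N then M else 0) else K i j).
  rewrite bmxT bmxM; apply: eq_bmx => i j im jm; rewrite /u.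
  case: eqP => [_|j0].
    by rewrite -KC //; apply: eq_bigr => k _; rewrite trmxK.
  rewrite -[RHS](@sum_bidr S m n i j) //; apply: eq_bigr => k _.
  by rewrite /bid eq_sym; case: eqP => _; rewrite ?trmx1 ?trmx0.
have UKU : bmx m u *m (bmx m K *m (bmx m u)^T) = bmx m (corner M) *m bmx m (cleared K).
  rewrite KU !bmxM; apply: eq_bmx => i j im jm; rewrite /u.
  have [->|i0] := eqVneq i 0%N.
    rewrite [RHS](sum_pick (a := 0%N) (f := fun k => corner M 0 k *m cleared K k j)) //; last first.
      move=> k km k0; rewrite /corner /bid (negbTE k0) andbF eq_sym (negbTE k0).
      by rewrite mul0mx.
    rewrite /corner /cleared /bid /= (eq_sym 0%N).
    have [_|j0] := eqVneq j 0%N.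
      rewrite (sum_pick (a := 0%N) (f := fun k => (C k)^T *m (if k == 0%N then M else 0))) //.
        by rewrite C0 trmx1 mul1mx mulmx1.
      by move=> k _ k0; rewrite (negbTE k0) mulmx0.
    rewrite mulmx0; transitivity (- (\sum_(k < m) K j k *m C k)^T).
      rewrite [in RHS]raddf_sum -sumrN; apply: eq_bigr => k _.
      by rewrite /= trmx_mul -mulmxN -Kskew.
    by rewrite KC // (negbTE j0) trmx0 oppr0.
  rewrite (sum_bid j (fun k j => if j == 0%N then (if k == 0%N then M else 0) else K k j)) //.
  rewrite (sum_pick (a := i) (f := fun k => corner M i k *m cleared K k j)) //; last first.
    by move=> k _ ki; rewrite /corner (negbTE i0) /bid (eq_sym i k) (negbTE ki) mul0mx.
  rewrite /corner /cleared (negbTE i0) /bid eqxx mul1mx /=.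
  by case: eqP => // ->; rewrite (negbTE i0).
exists (bmx m u), ((bmx m u)^T *m invmx (bmx m (cleared K))); split=> //.
- by rewrite unitmx_mul unitmx_tr uU unitmx_inv.
- by rewrite !mulmxA -(mulmxA (bmx m u)) UKU mulmxK.
rewrite mulmxA -trmx_mul Ue.
have eN : (ecol S m n 0)^T *m bmx m (cleared K) = (ecol S m n 0)^T.
  apply: trmx_inj; rewrite trmx_mul trmxK bmxT; apply: bmx_ecol => // a am.
  by rewrite /cleared /= /bid eq_sym; case: eqP; rewrite ?trmx1 ?trmx0.
by rewrite -{1}eN mulmxK.
Qed.

(** [ranked_unit] after permuting the columns by the involution s. *)
Lemma unit_reindex N (s r : nat -> nat) :
  (forall i, (i < m)%N -> (s i < m)%N) -> (forall i, s (s i) = i) ->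
  (forall i, (i < m)%N -> N i (s i) \in unitmx) ->
  (forall i j, (i < m)%N -> (j < m)%N -> j != s i -> N i j != 0 -> (r i < r (s j))%N) ->
  bmx m N \in unitmx.
Proof.
move=> s_lt sK hu hr.
have : bmx m (fun i j => N i (s j)) \in unitmx.
  apply: (ranked_unit (r := r)) => // i j im jm ij h.
  rewrite -(sK j) ; apply: hr => //; first exact: s_lt.
  by rewrite (inj_eq (can_inj sK)) eq_sym.
have -> : bmx m (fun i j => N i (s j)) = bmx m N *m bmx m (fun i j => bid i (s j)).
  rewrite bmxM; apply: eq_bmx => i j im jm.
  by rewrite (sum_bidr i N) // s_lt.
by rewrite unitmx_mul => /andP[].
Qed.

End ClearedCorner.

Section BaseEquivalence.
Variables (S : comUnitRingType) (m n : nat) (c : nat -> 'M[S]_n) (e : nat) (x : S).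
Hypothesis c_skew : forall i, (c i)^T = - c i.
Hypothesis c_deg : forall i, (m < i)%N -> c i = 0.
Hypotheses (lt_em : (e < m)%N) (e_even : ~~ odd e).
Hypothesis cm_unit : (e < m.-1)%N -> c m \in unitmx.
Local Notation U := (Ublk c e).
Local Notation V := (Vblk c e).

Definition signed (p : nat -> bool) (f : nat -> nat -> 'M[S]_n) i j :=
  if p i then f i j else - f i j.

Lemma signed_skew p f : skewf p f -> forall i j, signed p f j i = - (signed p f i j)^T.
Proof.
move=> h i j; rewrite /signed (h i j) /sgb.
by case: (p i); case: (p j) => /=; rewrite ?linearN ?opprK.
Qed.

Definition base_pencil (i j : nat) : 'M[S]_n := x *: U i j - V i j.

Lemma skewf_base_pencil : skewf (base_signs e) base_pencil.
Proof.
move=> i j; rewrite /base_pencil (skewf_U c_skew lt_em e_even i j) (skewf_V c_skew lt_em e_even i j).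
rewrite /sgb; case: ifP => _; rewrite linearB /= linearZ //=.
by rewrite scalerN opprB opprK addrC.
Qed.

Let K := signed (base_signs e) base_pencil.

(** At the positions (i, s i) the pencil has the blocks of - V on its alternating
    couplings and on the antidiagonal of its Hankel part, which are free of x and
    equal to - I or - A_m up to sign. Hankel entries beyond the antidiagonal
    vanish. A_m occurs here only if the Hankel part of V is not empty, that
    is for a nonzero index of z. *)
Lemma cleared_unit : bmx m (cleared K) \in unitmx.
Proof.
(* s pairs the odd labels below e with the next one and reflects those above e.
   The ranking r puts these odd labels last, in decreasing order; then every block
   at (i, j) with j != s i increases the rank from i to s j. *)
pose s i := if i == 0%N then 0%N else if (e < i)%N then (if (i < m)%N then m + e - i else i)%N
  else if odd i then i.+1 else i.-1.
pose r i := if odd i && (i < e)%N then (2 * m - i)%N else i.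
have unitN (M : 'M[S]_n) : (- M \in unitmx) = (M \in unitmx).
  by rewrite -scaleN1r unitmxZ // unitrN unitr1.
have nz (M : 'M[S]_n) : (- M == 0) = (M == 0) by rewrite oppr_eq0.
apply: (unit_reindex (s := s) (r := r)).
- by move=> i im; rewrite /s; split_ifs; lia.
- move=> i; rewrite {2}/s; split_ifs; rewrite /s; split_ifs; try lia.
  by rewrite eqxx; lia.
- move=> i im; rewrite /cleared /K /signed /base_pencil.
  have [->|i0] := eqVneq i 0%N; first by rewrite /= /bid unitmx1.
  have s0 : (s i == 0%N) = false by rewrite /s; split_ifs; lia.
  rewrite s0 (fun_if (fun M => M \in unitmx)) unitN if_same.
  rewrite /s (negbTE i0) im; case: ifP => ei.
    rewrite /Ublk /Vblk; split_ifs; rewrite c_deg ?scaler0 ?sub0r ?unitN; last by lia.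
    by rewrite (_ : _ - e = m)%N ?cm_unit; lia.
  by case: ifP => oi; rewrite /Ublk /Vblk; split_ifs; rewrite scaler0 sub0r unitN unitmx1.
move=> i j im jm; rewrite /cleared.
case: ifP => h0.
  rewrite /bid => js; have [ij _|_] := eqVneq i j; last by rewrite eqxx.
  by exfalso; move: js; rewrite /s; split_ifs; lia.
rewrite /K /signed (fun_if (fun M => M != 0)) nz if_same /base_pencil => js.
apply: contraR => rs; apply/eqP.
suff [-> ->] : U i j = 0 /\ V i j = 0 by rewrite scaler0 subr0.
move: js rs; rewrite /s; split_ifs; rewrite /r; split_ifs => js rs.
all: rewrite /Ublk /Vblk; split; split_ifs => //.
all: try by apply: c_deg; lia.
Qed.

Lemma base_equivalence :
  exists Ub Vb : 'M[S]_(m * n),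
    [/\ Ub \in unitmx, Vb \in unitmx,
        Ub *m bmx m K *m Vb = bmx m (corner (horner_shift m c x 0)),
        Ub *m ecol S m n 0 = ecol S m n 0 &
        (ecol S m n 0)^T *m Vb = (ecol S m n 0)^T].
Proof.
apply: (clear_congruence (C := factor_col m c e x)); first by lia.
- exact/signed_skew/skewf_base_pencil.
- by rewrite /factor_col ltn0 expr0.
- move=> i im; have := pencil_factor_col x c_deg lt_em e_even im.
  case pi : (base_signs e i) => h.
    by rewrite -h; apply: eq_bigr => k _; rewrite /K /signed pi.
  have i0 : (i == 0%N) = false by move: pi; rewrite /base_signs; lia.
  rewrite i0 in h *; apply: oppr_inj; rewrite oppr0; apply: (etrans _ h).
  by rewrite -sumrN; apply: eq_bigr => k _; rewrite /K /signed pi mulNmx opprK.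
- exact: cleared_unit.
Qed.

End BaseEquivalence.

(** * Quasi-identity matrices and pencils *)

Section QuasiIdentity.
Variables (F : fieldType) (m n : nat).
Implicit Types (f g : nat -> nat -> 'M[F]_n) (s : nat -> F).

Definition sgnmx s : 'M[F]_(m * n) :=
  bmx m (fun i j => if i == j then (s i)%:M else 0).

Lemma sgnmx_tens s :
  sgnmx s = diag_mx (\row_(i < m) s (rev_ord i)) *t (1%:M : 'M[F]_n).
Proof.
apply: bmx_matrixP => a b i j; rewrite bmxE tensmxE !mxE rev_ordK.
rewrite (can_eq rev_ordK) -val_eqE.
by case: eqP => _; rewrite !mxE ?mul0r // mulr1n mulr_natr.
Qed.

Lemma quasi_identityP Q : quasi_identity Q <->
  exists2 s : nat -> F, forall i, s i = 1 \/ s i = -1 & Q = sgnmx s.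
Proof.
split=> [[eps [heps ->]]|[s hs ->]]; last first.
  exists (\row_(i < m) s (rev_ord i)); split; last exact: sgnmx_tens.
  by move=> i; rewrite mxE; apply: hs.
pose s i := if insub i is Some k then eps 0 (rev_ord k) else 1.
exists s; first by move=> i; rewrite /s; case: insub => [k|]; [apply: heps | left].
rewrite sgnmx_tens; congr (diag_mx _ *t _); apply/rowP => i.
by rewrite mxE /s valK rev_ordK.
Qed.

Lemma sgnmx_bmx (S : comUnitRingType) (t : nat -> S) (k : nat -> nat -> 'M[S]_n) :
  bmx m (fun i j => if i == j then (t i)%:M else 0) *m bmx m k =
  bmx m (fun i j => t i *: k i j).
Proof.
rewrite bmxM; apply: eq_bmx => i j im jm.
rewrite (sum_pick (a := i) (f := fun l => (if i == l then (t i)%:M else 0) *m k l j)) //.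
  by rewrite eqxx mul_scalar_mx.
by move=> l _ li; rewrite eq_sym (negbTE li) mul0mx.
Qed.

Lemma cmx_bmx f : cmx (bmx m f) = bmx m (fun i j => cmx (f i j)).
Proof. by apply: bmx_matrixP => a b i j; rewrite !mxE !bmxE !mxE. Qed.

Lemma cmxM p q r (M : 'M[F]_(p, q)) (N : 'M_(q, r)) : cmx (M *m N) = cmx M *m cmx N.
Proof. exact: map_mxM. Qed.

Lemma cmx1 p : cmx (1%:M : 'M[F]_p) = 1%:M.
Proof. exact: map_mx1. Qed.

Lemma cmx0 p q : cmx (0 : 'M[F]_(p, q)) = 0.
Proof. exact: map_mx0. Qed.

Lemma cmxT p q (M : 'M[F]_(p, q)) : cmx M^T = (cmx M)^T.
Proof. by rewrite /cmx map_trmx. Qed.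

Lemma cmx_scalar p (a : F) : cmx (a%:M : 'M_p) = (a%:P)%:M.
Proof. exact: map_scalar_mx. Qed.

Lemma cmx_unit p (M : 'M[F]_p) : M \in unitmx -> cmx M \in unitmx.
Proof.
move=> uM; have : cmx M *m cmx (invmx M) = 1%:M by rewrite -cmxM mulmxV ?cmx1.
by case/mulmx1_unit.
Qed.

Definition pencil f g : 'M[{poly F}]_(m * n) :=
  'X *: cmx (bmx m f) - cmx (bmx m g).

Lemma sgnmx_pencil s f g : cmx (sgnmx s) *m pencil f g =
  bmx m (fun i j => (s i)%:P *: ('X *: cmx (f i j) - cmx (g i j))).
Proof.
rewrite /sgnmx /pencil !cmx_bmx bmxZ bmxB -sgnmx_bmx; congr (_ *m _).
by apply: eq_bmx => i j _ _; case: eqP => _; rewrite ?cmx_scalar ?cmx0.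
Qed.

(** The two coefficients of a pencil can be compared separately, and blockwise. *)
Lemma skew_pencil s f g :
  skew_symmetric (cmx (sgnmx s) *m pencil f g) <->
  (forall i j, (i < m)%N -> (j < m)%N ->
     s j *: (f j i)^T = - (s i *: f i j) /\ s j *: (g j i)^T = - (s i *: g i j)).
Proof.
rewrite /skew_symmetric sgnmx_pencil bmxT bmxN; split=> [h i j im jm|h].
  have {}h := bmx_inj h im jm.
  split; apply/matrixP => a b; have := congr1 (fun M : 'M_n => M a b) h;
    rewrite !mxE => e.
    have := congr1 (fun q : {poly F} => q`_1) e.
    by rewrite coefN !coefCM !coefB !coefXM !coefC /= !subr0.
  have := congr1 (fun q : {poly F} => - q`_0) e.
  by rewrite coefN !coefCM !coefB !coefXM !coefC /= !sub0r !mulrN !opprK.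
apply: eq_bmx => i j im jm; have [h1 h2] := h i j im jm.
have E (a : F) (M N : 'M[F]_n) : a%:P *: ('X *: cmx M - cmx N) =
    'X *: cmx (a *: M) - cmx (a *: N).
  have cZ (P : 'M[F]_n) : cmx (a *: P) = a%:P *: cmx P by apply: map_mxZ.
  by rewrite !cZ scalerBr !scalerA mulrC.
rewrite !E linearB /= linearZ /= -!cmxT !linearZ /= h1 h2.
have cN (P : 'M[F]_n) : cmx (- P) = - cmx P by apply: map_mxN.
by rewrite !cN scalerN opprD.
Qed.

End QuasiIdentity.

(** * One diagonal block of the linearization *)

Section OneSide.
Variables (F : fieldType) (m n h j : nat) (A : 'M[{poly F}]_n).
Variables (w z tw tz : seq nat).
Let p := (m - h - 1)%N.
Let e := (m.-1 - j)%N.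
Hypotheses (A_deg : mx_has_degree A m) (A_skew : skew_symmetric A).
Hypotheses (hm : (h < m)%N) (h_even : ~~ odd h).
Hypotheses (hw : admissible h 0 w) (hz : admissible p j z).
Hypotheses (htw : right_index_tuple1 h (rev w) tw).
Hypotheses (htz : right_index_tuple1 p (rev z) tz).

Let c := mxcoef A.

Lemma mxcoef_skew i : (c i)^T = - c i.
Proof.
apply/matrixP => a b; have := congr1 (fun M : 'M[{poly F}]_n => (M a b)`_i) (A_skew : A^T = - A).
by rewrite !mxE coefN.
Qed.

Let c_deg i : (m < i)%N -> c i = 0. Proof. by case: A_deg => _; apply. Qed.

Let cm_neq0 : c m != 0. Proof. by apply/eqP; case: A_deg. Qed.

(** The empty matrix is zero and so has no degree. *)
Lemma degree_dim : (0 < n)%N.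
Proof.
rewrite lt0n; apply: contra_neqN cm_neq0 => /eqP n0.
by apply/matrixP => a; have := ltn_ord a; rewrite {2}n0.
Qed.

Lemma elemA_ztuple t : all (ltn^~ m) t -> elemA_tuple m A (ztuple t) = prodm (wmat m c) t.
Proof.
rewrite /elemA_tuple /ztuple big_map => /allP ht.
rewrite /prodm big_seq [RHS]big_seq; apply: eq_bigr => i /ht im.
by rewrite /elemA elemmx_pos.
Qed.

Lemma elemA_shiftdown t : all (ltn^~ m) t ->
  elemA_tuple m A (shiftdown m t) = prodm (zmat m c) t.
Proof.
rewrite /elemA_tuple /shiftdown big_map => /allP ht.
rewrite /prodm big_seq [RHS]big_seq; apply: eq_bigr => i /ht /= im.
rewrite /zmat /zmove -elemmx_neg // /elemA; congr elemmx.
have -> : i%:Z - m%:Z = Negz (m - i).-1 by lia.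
by rewrite prednK //; lia.
Qed.

Local Notation xs := (hops m c h j tw tz).

Let jp : (j <= p)%N. Proof. by case: hz. Qed.
Let pjE : (p - j = (p - j)./2.*2)%N.
Proof. by case: hz => _ _ ho _; have := odd_double_half (p - j); rewrite (negbTE ho); lia. Qed.
Let e_even : ~~ odd e.
Proof.
have -> : e = (h + (p - j)./2.*2)%N by rewrite -pjE /e; lia.
by rewrite oddD odd_double addbF.
Qed.
Let lt_em : (e < m)%N. Proof. by rewrite /e; lia. Qed.

Lemma mem_symcompl q i : (i \in symcompl q j) -> (j <= q)%N -> (i < q)%N.
Proof.
rewrite mem_cat -/(odds j _) mem_odds => /orP[|/mem_revc]; last by move=> ? ?; lia.
by have := odd_double_half (q - j) => ? ? ?; lia.
Qed.

Local Notation L := (fiedler_pencil m A (ztuple w) (ztuple (symcompl h 0)) (ztuple tw)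
  (shiftdown m z) (shiftdown m (symcompl p j)) (shiftdown m tz)).

Let pf := sign_steps (base_signs e) xs.
Let cU := mcongs xs (Ublk c e).
Let cV := mcongs xs (Vblk c e).

Lemma fiedler_pencil_mcongs : L = pencil m cU cV.
Proof.
have [hv ltw ltz] := hops_valid mxcoef_skew hm h_even hw hz htw htz.
have all_w t : all (ltn^~ h) t -> all (ltn^~ m) t.
  by apply: sub_all => i /= ih; lia.
have all_z t : all (ltn^~ p) t -> all (ltn^~ m) t.
  by apply: sub_all => i /= ih; rewrite /p in ih; lia.
have all_wz q q' g : (q < m)%N -> admissible q q' g -> all (ltn^~ m) g.
  move=> qm [hg _ _ _]; apply/allP => i; rewrite (perm_mem hg) mem_iota /=; lia.
rewrite /fiedler_pencil -[rev (shiftdown m tz)]map_rev -[rev (ztuple tw)]map_rev.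
rewrite -/(shiftdown m (rev tz)) -/(ztuple (rev tw)).
have aw := all_wz _ _ _ hm hw.
have az : all (ltn^~ m) z by apply: (all_wz _ _ _ _ hz); rewrite /p; lia.
have acw : all (ltn^~ m) (symcompl h 0).
  apply: all_w; rewrite [symcompl h 0]cats0 subn0 -/(odds 0 _); apply/allP => i; rewrite mem_odds /=.
  by have := odd_double_half h; rewrite (negbTE h_even); lia.
have acz : all (ltn^~ m) (symcompl p j).
  by apply: all_z; apply/allP => i /mem_symcompl /=; apply.
have {}all_w := all_w _ ltw; have {}all_z := all_z _ ltz.
rewrite !elemA_ztuple ?all_rev // !elemA_shiftdown ?all_rev //.
rewrite /pencil /cU /cV.
rewrite -(pencil_mcongs c_deg hm h_even hw hz ltw ltz hv (or_introl (conj erefl erefl))).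
rewrite -(pencil_mcongs c_deg hm h_even hw hz ltw ltz hv (or_intror (conj erefl erefl))).
rewrite !cmxM mulmxBr !mulmxBl -scalemxAr -!scalemxAl.
by [].
Qed.

(** Where the unit column at label 0 goes: this is the position of the border
    blocks. *)
Lemma tracked_label :
  [/\ consecutions0 (w ++ symcompl h 0 ++ tw) = inversions0 (rev tw ++ w),
      (inversions0 (rev tw ++ w) < m)%N & 
      let g := inversions0 (rev tw ++ w) in
      [/\ pf g, emxs m (rev xs) *m ecol F m n 0 = ecol F m n g &
      (ecol F m n 0)^T *m emxs m xs = (ecol F m n g)^T]].
Proof.
have [hv ltw ltz] := hops_valid mxcoef_skew hm h_even hw hz htw htz.
have [h1 h2] := inversions0_consecutions0 tw hw.
have [||/=] := emxs_track (g := 0) hv => //; first by lia.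
by rewrite hops_track // h1 h2.
Qed.

Let s i : F := if pf i then 1 else -1.
Definition Qskew := sgnmx m n s.

Lemma Qskew_quasi_identity : quasi_identity Qskew.
Proof.
by apply/quasi_identityP; exists s => // i; rewrite /s; case: ifP; [left|right].
Qed.

Lemma Qskew_skew : skew_symmetric (cmx Qskew *m L).
Proof.
have [hv _ _] := hops_valid mxcoef_skew hm h_even hw hz htw htz.
rewrite fiedler_pencil_mcongs; apply/skew_pencil => i k _ _.
have E f : skewf pf f -> s k *: (f k i)^T = - (s i *: f i k).
  move=> hf; rewrite (hf i k) /sgb /s; case: (pf i); case: (pf k) => /=;
  by rewrite ?linearN /= trmxK ?scale1r ?scaleN1r ?opprK.
by split; apply: E; apply: (skewf_mcongs hv); [apply: skewf_U | apply: skewf_V] => //;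
  apply: mxcoef_skew.
Qed.

(** The labels where the two sign functions agree form a colouring that is
    constant along the nonzero blocks of both coefficients. A factor without
    column label occurs only for the indices 0 and -m, and the spine needs its
    block, A_0 or A_m, to be nonzero. *)
Lemma Qskew_unique Q : quasi_identity Q -> skew_symmetric (cmx Q *m L) ->
  (0%N \in tw -> mxcoef A 0 <> 0) -> Q = Qskew \/ Q = - Qskew.
Proof.
have [hv _ _] := hops_valid mxcoef_skew hm h_even hw hz htw htz.
move=> /quasi_identityP[t ht ->] + A0; have := Qskew_skew; rewrite fiedler_pencil_mcongs => /skew_pencil hs /skew_pencil hst.
have hs1 i : s i = 1 \/ s i = -1 by rewrite /s; case: (pf i); [left|right].
have nzs : all (@nonzero_move F n) xs.
  have hodd q k : 0%N \notin odds q k by rewrite mem_odds; lia.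
  have amap f (t' : seq nat) : (forall i, i \in t' -> nonzero_move (f i)) ->
      all (@nonzero_move F n) (map f t') by move=> hf; rewrite all_map; apply/allP.
  rewrite /hops !all_cat; apply/and4P; split; apply: amap => -[|i] //= hi.
  - by move: (hodd 0%N h./2); rewrite hi.
  - by move: (hodd j (p - j)./2); rewrite hi.
  - by rewrite /nonzero_move /= oppr_eq0; apply/eqP/A0.
  - by rewrite /nonzero_move /= subn0.
have [t1 [t2 [sp1 sp2 hl]]] := spine_mcongs hv nzs
  (spine_U mxcoef_skew lt_em e_even cm_neq0) (spine_V mxcoef_skew lt_em e_even cm_neq0)
  (linked_UV lt_em e_even).
have sgnP (a b a' b' : F) (M N : 'M[F]_n) : a = 1 \/ a = -1 -> b = 1 \/ b = -1 ->
    a' = 1 \/ a' = -1 -> b' = 1 \/ b' = -1 -> 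
    b *: N = - (a *: M) -> b' *: N = - (a' *: M) -> M != 0 -> (a' == a) = (b' == b).
  move=> ha hb ha' hb' e1 e2 M0.
  have {}e1 : N = - ((b * a) *: M).
    by rewrite -scalerA -scalerN -e1 scalerA; case: hb => ->; rewrite ?mulr1 ?mulrNN ?mulr1 scale1r.
  have {}e2 : N = - ((b' * a') *: M).
    by rewrite -scalerA -scalerN -e2 scalerA; case: hb' => ->; rewrite ?mulr1 ?mulrNN ?mulr1 scale1r.
  have /eqP : (b * a - b' * a') *: M = 0.
    by rewrite scalerBl; apply/eqP; rewrite subr_eq0; apply/eqP/oppr_inj; rewrite -e1 -e2.
  rewrite scaler_eq0 (negbTE M0) orbF subr_eq0 => /eqP e3.
  have nz0 (r : F) : r = 1 \/ r = -1 -> r != 0.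
    by case=> ->; rewrite ?oppr_eq0 oner_eq0.
  apply/eqP/eqP => e4; move: e3; rewrite e4.
    by move/(mulIf (nz0 _ ha)).
  by move/(mulfI (nz0 _ hb)).
(* Two skewness conditions on one nonzero block force the same relative sign. *)
pose d i := t i == s i.
have dU i k : (i < m)%N -> (k < m)%N -> cU i k != 0 -> d i = d k.
  move=> im km; have [h1 _] := hs i k im km; have [h2 _] := hst i k im km.
  exact: (sgnP _ _ _ _ _ _ (hs1 i) (hs1 k) (ht i) (ht k) h1 h2).
have dV i k : (i < m)%N -> (k < m)%N -> cV i k != 0 -> d i = d k.
  move=> im km; have [_ h1] := hs i k im km; have [_ h2] := hst i k im km.
  exact: (sgnP _ _ _ _ _ _ (hs1 i) (hs1 k) (ht i) (ht k) h1 h2).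
have dconst := linked_const degree_dim sp1 sp2 hl dU dV.
case d0 : (d 0%N); [left|right].
  apply: eq_bmx => i k im km; case: eqP => // _.
  have : d i by rewrite (dconst i 0%N) ?d0 //; lia.
  by move/eqP->.
rewrite /Qskew /sgnmx bmxN; apply: eq_bmx => i k im km; case: eqP => _; last by rewrite oppr0.
have : d i = false by rewrite (dconst i 0%N) ?d0 //; lia.
rewrite /d => /eqP ne; rewrite -scaleN1r scale_scalar_mx mulN1r.
by move: ne; case: (ht i) => ->; case: (hs1 i) => ->; rewrite ?opprK //.
Qed.

Hypothesis Am_unit0 : mxcoef A m \notin unitmx -> j = 0%N.
Hypothesis A0_unit : mxcoef A 0 \notin unitmx -> 0%N \notin tw.
Hypothesis Am_unit : mxcoef A m \notin unitmx -> 0%N \notin tz.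

Let Bc := base_pencil (fun i => cmx (c i)) e 'X.

Lemma horner_shift_mxcoef : horner_shift m (fun i => cmx (c i)) 'X 0 = A.
Proof.
apply/matrixP => a b; apply/polyP => i; rewrite /horner_shift summxE coef_sum.
have E l : (('X^l *: cmx (c (0 + l))) a b)`_i = if i == l then (A a b)`_i else 0.
  rewrite !mxE coefXnM coefC subn_eq0 add0n.
  by case: ltngtP => // ->.
under eq_bigr do rewrite E.
have [im|mi] := leqP i m.
  rewrite (bigD1 (inord i)) //= inordK // eqxx big1 ?addr0 // => l.
  by rewrite -val_eqE /= inordK // eq_sym => /negbTE ->.
rewrite big1 => [|l _]; last by rewrite gtn_eqF // (leq_trans (ltn_ord l)).
by have := congr1 (fun M : 'M[F]_n => M a b) (c_deg mi); rewrite !mxE.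
Qed.

Lemma cmx_base_pencil i k : Bc i k = 'X *: cmx (Ublk c e i k) - cmx (Vblk c e i k).
Proof.
have cN (P : 'M[F]_n) : cmx (- P) = - cmx P by apply: map_mxN.
by congr (_ *: _ - _); rewrite /Ublk /Vblk !(fun_if (@cmx F n n)) ?cN ?cmx1 ?cmx0.
Qed.

(** Only the factors of index 0 and -m need an invertible block. *)
Lemma hops_regular : all (@regular_move F n) xs.
Proof.
have hodd q k : 0%N \notin odds q k by rewrite mem_odds; lia.
have amap f (t' : seq nat) : (forall i, i \in t' -> regular_move (f i)) ->
    all (@regular_move F n) (map f t') by move=> hf; rewrite all_map; apply/allP.
rewrite /hops !all_cat; apply/and4P; split; apply: amap => -[|i] //= hi.
- by move: (hodd 0%N h./2); rewrite hi.
- by move: (hodd j (p - j)./2); rewrite hi.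
- rewrite /regular_move /= -scaleN1r unitmxZ ?unitrN ?unitr1 //.
  by apply: contraLR hi; apply: A0_unit.
- by rewrite /regular_move /= subn0; apply: contraLR hi; apply: Am_unit.
Qed.

Lemma sgnmxK (s' : nat -> F) : (forall i, s' i * s' i = 1) ->
  sgnmx m n s' *m sgnmx m n s' = 1%:M.
Proof.
move=> hs'; rewrite {1}/sgnmx sgnmx_bmx -bmx1; apply: eq_bmx => i k _ _.
by rewrite /bid; case: eqP => _; rewrite ?scaler0 // scale_scalar_mx hs'.
Qed.

Lemma sgnmx_ecol (s' : nat -> F) g : (g < m)%N -> s' g = 1 ->
  sgnmx m n s' *m ecol F m n g = ecol F m n g.
Proof.
move=> gm sg; apply: bmx_ecol => // a am; rewrite /bid.
by case: eqP => // ->; rewrite sg.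
Qed.

Lemma cmx_ecol g : cmx (ecol F m n g) = ecol {poly F} m n g.
Proof.
rewrite /cmx /ecol map_mxT map_mx1; congr (_ *t _).
by apply/colP => i; rewrite !mxE rmorph_nat.
Qed.

(** The congruence with M_t, multiplied by the signs before and after it, is
    invertible over the base field and carries the equivalence for the base
    pencil over. The tracked label and label 0 have sign plus, so the signs do
    not act on the unit vectors to which the border is attached. *)
Lemma side_equivalence : let g := inversions0 (rev tw ++ w) in
  exists U V : 'M[{poly F}]_(m * n),
    [/\ U \in unitmx, V \in unitmx, U *m (cmx Qskew *m L) *m V = bmx m (corner A),
        U *m ecol {poly F} m n g = ecol {poly F} m n 0 &
        (ecol {poly F} m n g)^T *m V = (ecol {poly F} m n 0)^T].
Proof.
move=> g; have m_gt0 : (0 < m)%N by apply: leq_ltn_trans hm.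
have [hv _ _] := hops_valid mxcoef_skew hm h_even hw hz htw htz.
have [_ gm [pg tl tr]] := tracked_label; rewrite -/g in gm pg tl tr.
have cp_skew i : (cmx (c i))^T = - cmx (c i).
  by rewrite -cmxT mxcoef_skew; apply: map_mxN.
have cp_deg i : (m < i)%N -> cmx (c i) = 0 by move=> /c_deg ->; apply: cmx0.
have cp_unit : (e < m.-1)%N -> cmx (c m) \in unitmx.
  rewrite /e => em; apply: cmx_unit; apply: contraT => /Am_unit0 j0; lia.
have [Ub [Vb [uU uV UKV Ue Ve]]] :=
  base_equivalence 'X cp_skew cp_deg lt_em e_even cp_unit.
rewrite horner_shift_mxcoef in UKV.
pose s0 i : F := if base_signs e i then 1 else -1.
pose Wl := emxs m (rev xs); pose Wr := emxs m xs.
have uWl : Wl \in unitmx.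
  by apply: emxs_unit; rewrite all_rev ?(valid_wf hv) ?hops_regular.
have uWr : Wr \in unitmx by apply: emxs_unit; rewrite ?(valid_wf hv) ?hops_regular.
have s1 i : s i * s i = 1 by rewrite /s; case: ifP; rewrite ?mulr1 ?mulrNN ?mulr1.
have s01 i : s0 i * s0 i = 1 by rewrite /s0; case: ifP; rewrite ?mulr1 ?mulrNN ?mulr1.
have s00 : s0 0%N = 1 by [].
(* Q0 turns the base pencil skew-symmetric, so that T compares the two skew
   forms: Q_A L_A = T (Q0 (x U - V)) Wr *)
pose Q0 := sgnmx m n s0; pose T := Qskew *m Wl *m Q0.
have uT : T \in unitmx.
  rewrite !unitmx_mul uWl andbT; apply/andP; split.
    by case/mulmx1_unit: (sgnmxK s1).
  by case/mulmx1_unit: (sgnmxK s01).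
have Te : T *m ecol F m n 0 = ecol F m n g.
  have e0 : Q0 *m ecol F m n 0 = ecol F m n 0 by exact: (sgnmx_ecol m_gt0 s00).
  have eg : Qskew *m ecol F m n g = ecol F m n g by apply: sgnmx_ecol; rewrite // /s pg.
  by rewrite /T -!mulmxA e0 tl eg.
have LE : cmx Qskew *m L = cmx T *m bmx m (signed (base_signs e) Bc) *m cmx Wr.
  rewrite fiedler_pencil_mcongs.
  have -> : pencil m cU cV = cmx Wl *m pencil m (Ublk c e) (Vblk c e) *m cmx Wr.
    rewrite /pencil /cU /cV !(bmx_mcongs _ hv) !cmxM.
    by rewrite mulmxBr mulmxBl -scalemxAr -scalemxAl.
  have -> : bmx m (signed (base_signs e) Bc) = cmx Q0 *m pencil m (Ublk c e) (Vblk c e).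
    rewrite sgnmx_pencil; apply: eq_bmx => i k _ _; rewrite -cmx_base_pencil /signed /s0.
    by case: ifP => _; rewrite ?polyCN ?scale1r ?scaleN1r.
  rewrite /T !cmxM -!mulmxA; do 2 congr (_ *m _).
  by rewrite !mulmxA -cmxM sgnmxK // cmx1 mul1mx.
exists (Ub *m cmx (invmx T)), (cmx (invmx Wr) *m Vb); split.
- by rewrite unitmx_mul uU cmx_unit ?unitmx_inv.
- by rewrite unitmx_mul uV cmx_unit ?unitmx_inv.
- have eT : cmx (invmx T) *m cmx T = 1%:M by rewrite -cmxM mulVmx // cmx1.
  have eW : cmx Wr *m cmx (invmx Wr) = 1%:M by rewrite -cmxM mulmxV // cmx1.
  rewrite LE -UKV -!mulmxA (mulmxA (cmx (invmx T))) eT mul1mx.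
  by rewrite (mulmxA (cmx Wr)) eW mul1mx.
- by rewrite -(cmx_ecol g) -Te -mulmxA -cmxM mulKmx // cmx_ecol.
- rewrite -(cmx_ecol g) mulmxA -cmxT -cmxM -tr mulmxK // cmxT cmx_ecol.
  exact: Ve.
Qed.

End OneSide.

(** * Assembling the two diagonal blocks *)

Section Reversal.
Variables (S : comUnitRingType) (m n : nat).

(** The D-part is reduced with D at the last block, label 0, but the system matrix
    needs it at the first one; reversing the order of the blocks moves it. *)
Definition revmx : 'M[S]_(m * n) :=
  bmx m (fun i j => if (i + j == m.-1)%N then 1%:M else 0).

Lemma revmx_conjugate f : revmx *m bmx m f *m revmx =
  bmx m (fun i j => f (m.-1 - i)%N (m.-1 - j)%N).
Proof.
rewrite !bmxM; apply: eq_bmx => i j im jm.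
rewrite (sum_pick (a := (m.-1 - j)%N) (f := fun k =>
   (\sum_(l < m) (if (i + l == m.-1)%N then 1%:M else 0) *m f l k) *m
     (if (k + j == m.-1)%N then 1%:M else 0))).
- rewrite ifT ?mulmx1; last by lia.
  rewrite (sum_pick (a := (m.-1 - i)%N) (f := fun l =>
     (if (i + l == m.-1)%N then 1%:M else 0) *m f l (m.-1 - j)%N)).
  + by rewrite ifT ?mul1mx; last by lia.
  + by lia.
  + by move=> l lm li; rewrite ifN ?mul0mx; last by lia.
- by lia.
- by move=> l lm lj; rewrite ifN ?mulmx0; last by lia.
Qed.

Lemma revmxK : revmx *m revmx = 1%:M.
Proof.
have := revmx_conjugate (@bid S n); rewrite bmx1 mulmx1 => ->.
by rewrite -bmx1; apply: eq_bmx => i j im jm; rewrite /bid; congr (if _ then _ else _); lia.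
Qed.

Lemma revmx_unit : revmx \in unitmx.
Proof. by case/mulmx1_unit: revmxK. Qed.

Lemma revmxT : revmx^T = revmx.
Proof.
rewrite /revmx bmxT; apply: eq_bmx => i j _ _; rewrite addnC.
by case: eqP; rewrite ?trmx1 ?trmx0.
Qed.

Lemma revmx_ecol : (0 < m)%N -> revmx *m ecol S m n 0 = ecol S m n m.-1.
Proof. by move=> m0; apply: bmx_ecol => // a am; rewrite addn0. Qed.

End Reversal.

Section Assembly.
Variables (S : comUnitRingType) (m k n r : nat).

(** A border block is a block unit column times the small matrix times a block unit
    row, so the two sides can be transformed independently. *)
Lemma tens_outer a b (M : 'M[S]_(n, r)) :
  (stdvec S m a *m (stdvec S k b)^T) *t M =
  (stdvec S m a *t 1%:M) *m ((1%:M : 'M_1) *t M) *m (stdvec S k b *t 1%:M)^T.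
Proof. by rewrite trmx_tens trmx1 !tensmx_mul mulmx1 mul1mx mulmx1. Qed.

(** The four kinds of rows (ordinary and distinguished, of the A-part and of the
    D-part), each with its position in the two ways of cutting the matrix into
    blocks. *)
Variant pos_spec : 'I_(m.+1 * n + k.+1 * r) -> 'I_(m * n + (n + r) + k * r) -> Prop :=
| PosA (a : 'I_m) (i : 'I_n) : pos_spec
    (lshift _ (mxtens_index (widen_ord (leqnSn m) a, i))) (lshift _ (lshift _ (mxtens_index (a, i))))
| PosA0 (i : 'I_n) : pos_spec
    (lshift _ (mxtens_index (ord_max, i))) (lshift _ (rshift _ (lshift _ i)))
| PosD0 (i : 'I_r) : pos_spec
    (rshift _ (mxtens_index (ord0, i))) (lshift _ (rshift _ (rshift _ i)))
| PosD (b : 'I_k) (i : 'I_r) : pos_spec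
    (rshift _ (mxtens_index (lift ord0 b, i))) (rshift _ (mxtens_index (b, i))).

Lemma posP (e : (m * n + (n + r) + k * r = m.+1 * n + k.+1 * r)%N) x :
  pos_spec x (cast_ord (esym e) x).
Proof.
case: (split_ordP x) => y ->; case: (mxtens_indexP y) => a i {x y}.
  case: (unliftP ord_max a) => [b ->|->].
    have -> : lift ord_max b = widen_ord (leqnSn m) b.
      by apply: val_inj => /=; rewrite /bump leqNgt ltn_ord.
    rewrite (_ : cast_ord _ _ = lshift _ (lshift _ (mxtens_index (b, i)))); first exact: PosA.
    exact: val_inj.
  rewrite (_ : cast_ord _ _ = lshift _ (rshift _ (lshift _ i))); first exact: PosA0.
  exact: val_inj.
case: (unliftP ord0 a) => [b ->|->].
  rewrite (_ : cast_ord _ _ = rshift _ (mxtens_index (b, i))); first exact: PosD.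
  by apply: val_inj; rewrite /= /bump /= add1n !mulSn; lia.
rewrite (_ : cast_ord _ _ = lshift _ (rshift _ (rshift _ i))); first exact: PosD0.
by apply: val_inj; rewrite /= mul0n !mulSn; lia.
Qed.

Lemma assembled_blocks (A : 'M[S]_n) B C (D : 'M[S]_r)
    (e : (m * n + (n + r) + k * r = m.+1 * n + k.+1 * r)%N) :
  block_mx (bmx m.+1 (corner A))
           ((stdvec S m.+1 m.+1 *m (stdvec S k.+1 1)^T) *t B)
           ((stdvec S k.+1 1 *m (stdvec S m.+1 m.+1)^T) *t C)
           (bmx k.+1 (fun i j => corner D (k - i)%N (k - j)%N)) =
  castmx (e, e) (block_mx (block_mx 1%:M 0 0 (block_mx A B C D)) 0 0 1%:M).
Proof.
have outer m' k' a b (i : 'I_m') (j : 'I_k') :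
    (stdvec S m' a *m (stdvec S k' b)^T) i j = ((i.+1 == a) && (j.+1 == b))%:R.
  by rewrite mxE big_ord1 !mxE -natrM mulnb.
have eA (a : 'I_m) : nat_of_ord (rev_ord (widen_ord (leqnSn m) a)) = (m - a.+1).+1.
  by have := ltn_ord a; rewrite /=; lia.
have eA0 : nat_of_ord (rev_ord (ord_max : 'I_m.+1)) = 0%N by rewrite /= subnn.
have eD0 : (k - rev_ord (ord0 : 'I_k.+1) = 0)%N by rewrite /=; lia.
have eD (a : 'I_k) : (k - rev_ord (lift ord0 a) = a.+1)%N.
  by have := ltn_ord a; rewrite /= /bump /=; lia.
have fA (a : 'I_m) : ((widen_ord (leqnSn m) a).+1 == m.+1) = false.
  by have := ltn_ord a; rewrite /=; lia.
have fD (a : 'I_k) : ((lift ord0 a).+1 == 1)%N = false by [].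
have diag N (p : nat) (a b : 'I_N) (i j : 'I_p) (c : bool) : (a == b) = c ->
    (if c then 1%:M else 0 : 'M[S]_p) i j =
    (mxtens_index (a, i) == mxtens_index (b, j))%:R.
  move=> <-; rewrite (can_eq (@mxtens_indexK _ _)) xpair_eqE.
  by case: eqP => _; rewrite mxE.
apply/matrixP => x y; rewrite castmxE /=.
case: (posP e x) => [a i|i|i|a i]; case: (posP e y) => [b j|j|j|b j];
  rewrite ?(block_mxEul, block_mxEur, block_mxEdl, block_mxEdr) ?blocksE ?tensmxE ?outer
    ?eA ?eA0 ?eD0 ?eD ?fA ?fD ?eqxx ?andbF ?mul0r ?mul1r /corner /bid /= ?mul1r ?mxE //.
  by apply: diag; have := ltn_ord a; have := ltn_ord b; rewrite -val_eqE /=; lia.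
by apply: diag; rewrite eqSS.
Qed.

End Assembly.

Section Bordered.
Variables (F : fieldType) (m k n r : nat).
Implicit Types (LA : 'M[{poly F}]_(m * n)) (LD : 'M[{poly F}]_(k * r)) (B : 'M[F]_(n, r)).

(** The two border blocks are minus the transpose of each other by construction. *)
Lemma skew_bordered QA LA QD LD B a b :
  skew_symmetric (bordered_pencil QA LA QD LD B a b b a) <->
  skew_symmetric (cmx QA *m LA) /\ skew_symmetric (cmx QD *m LD).
Proof.
rewrite /skew_symmetric /bordered_pencil tr_block_mx opp_block_mx.
have cN p q (P : 'M[F]_(p, q)) : cmx (- P) = - cmx P by apply: map_mxN.
have E : (cmx ((stdvec F k b *m (stdvec F m a)^T) *t B^T))^T =
    - cmx ((stdvec F m a *m (stdvec F k b)^T) *t (- B)).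
  rewrite -cmxT trmx_tens trmx_mul !trmxK -cN; congr cmx.
  by apply/matrixP => i j; rewrite !mxE mulrN opprK.
split=> [/eq_block_mx[-> _ _ ->]//|[-> ->]]; congr block_mx; first exact: E.
have -> : cmx ((stdvec F m a *m (stdvec F k b)^T) *t (- B)) =
    - (cmx ((stdvec F k b *m (stdvec F m a)^T) *t B^T))^T by rewrite E opprK.
by rewrite linearN /= trmxK.
Qed.

Lemma rosenbrock_bordered G (A : 'M[{poly F}]_n) (D : 'M[{poly F}]_r) QA LA QD LD B a b :
  G = transfer_function A B D -> (a < m)%N -> (b < k)%N ->
  (exists U V : 'M[{poly F}]_(m * n),
    [/\ U \in unitmx, V \in unitmx, U *m (cmx QA *m LA) *m V = bmx m (corner A),
        U *m ecol {poly F} m n a = ecol {poly F} m n 0 &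
        (ecol {poly F} m n a)^T *m V = (ecol {poly F} m n 0)^T]) ->
  (exists U V : 'M[{poly F}]_(k * r),
    [/\ U \in unitmx, V \in unitmx, U *m (cmx QD *m LD) *m V = bmx k (corner D),
        U *m ecol {poly F} k r b = ecol {poly F} k r 0 &
        (ecol {poly F} k r b)^T *m V = (ecol {poly F} k r 0)^T]) ->
  rosenbrock_linearization G A B D
    (bordered_pencil QA LA QD LD B (m - a) (k - b) (k - b) (m - a)).
Proof.
move=> GE am bk [UA [VA [uUA uVA EA eUA eVA]]] [UD [VD [uUD uVD ED eUD eVD]]].
split=> //.
have m0 : (0 < m)%N by apply: leq_ltn_trans am.
have k0 : (0 < k)%N by apply: leq_ltn_trans bk.
have e : (m.-1 * n + (n + r) + k.-1 * r = m * n + k * r)%N.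
  by rewrite -{2}(prednK m0) -{2}(prednK k0) !mulSn; lia.
pose J := revmx {poly F} k r.
exists e, UA, VA, (J *m UD), (VD *m J); split=> //; rewrite ?unitmx_mul ?revmx_unit ?uUD ?uVD //.
have cmx_tens p q u v (X : 'M[F]_(p, q)) (Y : 'M[F]_(u, v)) : cmx (X *t Y) = cmx X *t cmx Y.
  exact: map_mxT.
have cmx_std N i : cmx (stdvec F N i) = stdvec {poly F} N i.
  by apply/colP => x; rewrite !mxE rmorph_nat.
have eJ : J *m ecol {poly F} k r 0 = ecol {poly F} k r k.-1 by apply: revmx_ecol.
have eJT : (ecol {poly F} k r 0)^T *m J = (ecol {poly F} k r k.-1)^T.
  by apply: trmx_inj; rewrite trmx_mul !trmxK revmxT.
have stdA : stdvec {poly F} m m *t 1%:M = ecol {poly F} m n 0 by rewrite /ecol subn0.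
have stdD : stdvec {poly F} k 1 *t 1%:M = ecol {poly F} k r k.-1.
  by rewrite /ecol; congr (stdvec _ _ _ *t _); lia.
have E22 : J *m UD *m (cmx QD *m LD) *m (VD *m J) =
    bmx k (fun i j => corner D (k.-1 - i)%N (k.-1 - j)%N).
  by rewrite -(revmx_conjugate _ (corner D)) -ED !mulmxA.
have E12 M : UA *m cmx ((stdvec F m (m - a) *m (stdvec F k (k - b))^T) *t M) *m (VD *m J) =
    (stdvec {poly F} m m *m (stdvec {poly F} k 1)^T) *t (cmx M).
  rewrite cmx_tens cmxM cmxT !cmx_std !tens_outer stdA stdD -/(ecol _ m n a) -/(ecol _ k r b).
  by rewrite -eUA -eJT -eVD !mulmxA.
have E21 M : J *m UD *m cmx ((stdvec F k (k - b) *m (stdvec F m (m - a))^T) *t M) *m VA =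
    (stdvec {poly F} k 1 *m (stdvec {poly F} m m)^T) *t (cmx M).
  rewrite cmx_tens cmxM cmxT !cmx_std !tens_outer stdA stdD -/(ecol _ m n a) -/(ecol _ k r b).
  by rewrite -eVA -eJ -eUD !mulmxA.
rewrite /bordered_pencil !mulmx_block !(mul0mx, mulmx0, addr0, add0r).
rewrite E12 E21 E22 EA /system_matrix (_ : cmx (- B) = - cmx B); last exact: map_mxN.
case: m k m0 k0 e {LA LD UA VA UD VD uUA uVA uUD uVD EA ED eUA eVA eUD eVD J eJ eJT stdA stdD E12 E21 E22 QA QD am bk} => [|m'] [|k'] // _ _ e.
by rewrite -assembled_blocks.
Qed.

End Bordered.

(** * The theorem *)

Lemma simple_admissible_even h q w :
  ~~ odd h -> simple_admissible h q w -> q = 0%N.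
Proof.
move=> he [[_ qh qo _]]; rewrite !inE => /orP[/eqP //|/eqP q1].
by move: qo; rewrite q1; move: qh he; rewrite q1; lia.
Qed.

Lemma mem_shiftdown_min m t : (- m%:Z \in shiftdown m t) = (0%N \in t).
Proof.
apply/mapP/idP => [[i it e]|t0]; last by exists 0%N; rewrite // add0r.
by have -> : 0%N = i by lia.
Qed.

(* The variables zA and zD stand for z_h + m and z_l + k, tzA and tzD for
   t_{z_h} + m and t_{z_l} + k; jA and jD are the indices of zA and zD. *)
Theorem theorem3p18 (R : realType) (m k n r : nat)
    (G : 'M[{fraction {poly R[i]}}]_r)
    (A : 'M[{poly R[i]}]_n) (B : 'M[R[i]]_(n, r)) (D : 'M[{poly R[i]}]_r)
    (hG : skew_realization m k G A B D)
    (h : nat) (hm : (h < m)%N) (h_even : ~~ odd h)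
    (iw : nat) (w : seq nat) (hw : simple_admissible h iw w)
    (jA : nat) (zA : seq nat) (hzA : admissible (m - h - 1) jA zA)
    (tw : seq nat) (htw : right_index_tuple1 h (rev w) tw)
    (tzA : seq nat) (htzA : right_index_tuple1 (m - h - 1) (rev zA) tzA)
    (l : nat) (lk : (l < k)%N) (l_even : ~~ odd l)
    (iv : nat) (v : seq nat) (hv : simple_admissible l iv v)
    (jD : nat) (zD : seq nat) (hzD : admissible (k - l - 1) jD zD)
    (tv : seq nat) (htv : right_index_tuple1 l (rev v) tv)
    (tzD : seq nat) (htzD : right_index_tuple1 (k - l - 1) (rev zD) tzD) :
  let cw := symcompl h iw in
  let cv := symcompl l iv in
  let z_h := shiftdown m zA in
  let c_zh := shiftdown m (symcompl (m - h - 1) jA) in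
  let t_zh := shiftdown m tzA in
  let z_l := shiftdown k zD in
  let c_zl := shiftdown k (symcompl (k - l - 1) jD) in
  let t_zl := shiftdown k tzD in
  let LA := fiedler_pencil m A (ztuple w) (ztuple cw) (ztuple tw) z_h c_zh t_zh in
  let LD := fiedler_pencil k D (ztuple v) (ztuple cv) (ztuple tv) z_l c_zl t_zl in
  let LL QA QD := bordered_pencil QA LA QD LD B
    (m - inversions0 (rev tw ++ w)) (k - consecutions0 (v ++ cv ++ tv))
    (k - inversions0 (rev tv ++ v)) (m - consecutions0 (w ++ cw ++ tw)) in
  exists (QA : 'M[R[i]]_(m * n)) (QD : 'M[R[i]]_(k * r)),
    [/\ quasi_identity QA, quasi_identity QD,
        skew_symmetric (LL QA QD),
        (* uniqueness, up to the sign of each of the two matrices *)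
        forall (QA' : 'M[R[i]]_(m * n)) (QD' : 'M[R[i]]_(k * r)),
          quasi_identity QA' -> quasi_identity QD' ->
          skew_symmetric (LL QA' QD') ->
          ((0%N \in tw -> mxcoef A 0 <> 0) -> QA' = QA \/ QA' = - QA) /\
          ((0%N \in tv -> mxcoef D 0 <> 0) -> QD' = QD \/ QD' = - QD)
      & (mxcoef A m \notin unitmx -> jA = 0%N) ->
        (mxcoef A 0 \notin unitmx -> 0%N \notin tw) ->
        (mxcoef A m \notin unitmx -> - m%:Z \notin t_zh) ->
        (mxcoef D k \notin unitmx -> jD = 0%N) ->
        (mxcoef D 0 \notin unitmx -> 0%N \notin tv) ->
        (mxcoef D k \notin unitmx -> - k%:Z \notin t_zl) ->
        rosenbrock_linearization G A B D (LL QA QD)].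
Proof.
case: hG => -[_ degA] degD skA skD GE.
have iw0 := simple_admissible_even h_even hw; subst iw.
have iv0 := simple_admissible_even l_even hv; subst iv.
case: hw => aw _; case: hv => av _.
have [cA gA _] := tracked_label degA skA hm h_even aw hzA htw htzA.
have [cD gD _] := tracked_label degD skD lk l_even av hzD htv htzD.
move=> cw cv z_h c_zh t_zh z_l c_zl t_zl LA LD LL.
have LLE Q Q' : LL Q Q' = bordered_pencil Q LA Q' LD B
    (m - inversions0 (rev tw ++ w)) (k - inversions0 (rev tv ++ v))
    (k - inversions0 (rev tv ++ v)) (m - inversions0 (rev tw ++ w)).
  by rewrite /LL /cw /cv cA cD.
exists (Qskew m h jA A tw tzA), (Qskew k l jD D tv tzD); split.
- exact: Qskew_quasi_identity.
- exact: Qskew_quasi_identity.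
- rewrite LLE; apply/skew_bordered; split; first exact: (Qskew_skew degA skA hm h_even aw hzA htw htzA).
  exact: (Qskew_skew degD skD lk l_even av hzD htv htzD).
- move=> Q Q' hQ hQ'; rewrite LLE => /skew_bordered[sQ sQ']; split=> h0.
    exact: (Qskew_unique degA skA hm h_even aw hzA htw htzA hQ sQ h0).
  exact: (Qskew_unique degD skD lk l_even av hzD htv htzD hQ' sQ' h0).
rewrite /t_zh /t_zl !mem_shiftdown_min => uA1 uA2 uA3 uD1 uD2 uD3; rewrite LLE.
apply: rosenbrock_bordered => //.
  exact: (side_equivalence degA skA hm h_even aw hzA htw htzA uA1 uA2 uA3).
exact: (side_equivalence degD skD lk l_even av hzD htv htzD uD1 uD2 uD3).
Qed.
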